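(* Let $R$ be a commutative Noetherian ring (with non-zero identity), $N$ a non-zero finitely generated $R$-module and $I$ an $N$-proper ideal of $R$ (i.e. $N/IN\ne 0$) such that $E(I,N)=\operatorname{mAss}_R N/IN$. Then the $I$-adic topology on $N$, given by $\{I^nN\}_{n\ge 0}$, and the topology defined by the filtration $\{(IN)^{(n)}\}_{n\ge 0}$ are linearly equivalent; that is, there is an integer $k\ge 0$ such that $(IN)^{(n+k)}\subseteq I^nN$ for all integers $n\ge 0$.
   Context: $\operatorname{mAss}_R N/IN$ denotes the set of minimal elements (under inclusion) of $\operatorname{Ass}_R N/IN$. With $S=R\setminus\bigcup\{\mathfrak p:\mathfrak p\in\operatorname{mAss}_R N/IN\}$, one sets $(IN)^{(n)}:=\bigcup_{s\in S}(I^nN:_N s)$, where $I^nN:_N s=\{x\in N: sx\in I^nN\}$. Quintessential primes: for a Noetherian ring $A$, an ideal $J$ of $A$ and a finitely generated $A$-module $M$, $Q(J,M)$ is the set of prime ideals $\mathfrak p$ of $A$ for which there exists $\mathfrak q\in\operatorname{Ass}_{\widehat{A_{\mathfrak p}}}\widehat{M_{\mathfrak p}}$ with $\operatorname{Rad}(J\widehat{A_{\mathfrak p}}+\mathfrak q)=\mathfrak p\widehat{A_{\mathfrak p}}$, where $\widehat{\ \ }$ is the $\mathfrak pA_{\mathfrak p}$-adic completion and $\operatorname{Rad}$ is the radical of an ideal. Rees objects: for an indeterminate $t$ and $u=t^{-1}$, the extended Rees ring is $R[It,u]=\bigoplus_{n\in\mathbb Z}I^nt^n$ (with $I^n=R$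 for $n\le 0$), and the extended Rees module is $N[It,u]=\bigoplus_{n\in\mathbb Z}I^nN$ (with $I^nN=N$ in degree $n$ for $n\le 0$), a finitely generated graded $R[It,u]$-module. Essential primes: $E(I,N):=\{\mathfrak q\cap R : \mathfrak q\in Q(uR[It,u],\,N[It,u])\}$. *)

(* Defs.v *)
From HB Require Import structures.
From mathcomp Require Import all_boot all_order all_algebra ring zify.
From mathcomp Require Import finmap all_classical.

Set Implicit Arguments.
Unset Strict Implicit.
Unset Printing Implicit Defensive.

Import GRing.Theory.

Local Open Scope classical_set_scope.
Local Open Scope ring_scope.

Lemma scale_regularE (A : pzRingType) (a b : A) : a *: (b : A^o) = a * b.
Proof. by []. Qed.

Section Submodules.
Variables (A : comPzRingType) (M : lmodType A).
Implicit Types (P X : set M) (I : set A).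

Definition is_submodule P : Prop := submod_closed (mem P).

Lemma is_submoduleP P :
  is_submodule P <->
  [/\ P 0, forall x y, P x -> P y -> P (x + y) & forall a x, P x -> P (a *: x)].
Proof.
rewrite /is_submodule; split => [[/set_mem P0 lin]|[P0 PD PZ]].
  split=> // [x y Px Py|a x Px].
    by rewrite -[x]scale1r; apply: set_mem; apply: lin; exact: mem_set.
  by rewrite -[_ *: _]addr0; apply: set_mem; apply: lin; exact: mem_set.
split=> [|a x y /set_mem Px /set_mem Py]; apply: mem_set => //.
by apply: PD => //; apply: PZ.
Qed.

Definition span X : set M := smallest is_submodule X.

Lemma span_submodule X : is_submodule (span X).
Proof.
apply/is_submoduleP; split=> [P [/is_submoduleP[]] //|x y Sx Sy P PP|
  a x Sx P PP].
  by have [/is_submoduleP[_ PD _] _] := PP; apply: PD; [exact: Sx|exact: Sy].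
by have [/is_submoduleP[_ _ PZ] _] := PP; apply: PZ; exact: Sx.
Qed.

Lemma span_ind X P : is_submodule P -> X `<=` P -> span X `<=` P.
Proof. exact: smallest_sub. Qed.

Definition smul I P : set M := span [set a *: x | a in I & x in P].

Lemma smul_submodule I P : is_submodule (smul I P).
Proof. exact: span_submodule. Qed.

Lemma submoduleB P x y : is_submodule P -> P x -> P y -> P (x - y).
Proof. by case/is_submoduleP=> _ PD PZ Px Py; rewrite -scaleN1r; auto. Qed.

Lemma submoduleN P x : is_submodule P -> P x -> P (- x).
Proof. by case/is_submoduleP=> _ PD PZ Px; rewrite -scaleN1r; auto. Qed.

Lemma smul_sub I P : is_submodule P -> smul I P `<=` P.
Proof.
move=> PP; apply: span_ind => // _ [a _ [x Px <-]].
by have [_ _] := (is_submoduleP P).1 PP; apply.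
Qed.

Record submodule := Submodule {
  submodule_set :> set M;
  submoduleP : is_submodule submodule_set
}.

Definition submodule_pred (P : submodule) : {pred M} := mem (P : set M).

Lemma submodule_zmod_closed (P : submodule) : zmod_closed (submodule_pred P).
Proof. exact: GRing.submod_closedB (submoduleP P). Qed.

HB.instance Definition _ (P : submodule) :=
  GRing.isZmodClosed.Build M (submodule_pred P) (submodule_zmod_closed P).

Definition smulm I P : submodule := Submodule (smul_submodule I P).

Definition finitely_generated : Prop :=
  exists s : seq M, span [set` s] = [set: M].

End Submodules.

Section QuotientModule.
Variables (A : comPzRingType) (M : lmodType A) (P : submodule M).

Definition quotm : Type := Quotient.quot (submodule_pred P).
HB.instance Definition _ := GRing.Zmodule.on quotm.
HB.instance Definition _ := EqQuotient.on quotm.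

Definition quotm_scale (a : A) (x : quotm) : quotm :=
  \pi_(quotm)%qT (a *: repr x).

Lemma quotm_reprK x : \pi_(quotm)%qT (repr x) = x.
Proof. exact: reprK. Qed.

Lemma quotm_piP x y :
  (\pi_(quotm)%qT x = \pi_(quotm)%qT y) <-> (P : set M) (x - y).
Proof.
split=> [/eqP|Pxy].
  by rewrite -Quotient.idealrBE => /set_mem.
by apply/eqP; rewrite -Quotient.idealrBE; exact: mem_set.
Qed.

Lemma quotm_scaleE a x :
  quotm_scale a (\pi_(quotm)%qT x) = \pi_(quotm)%qT (a *: x).
Proof.
apply/quotm_piP; rewrite -scalerBr.
have [_ _] := (is_submoduleP P).1 (submoduleP P); apply.
by apply/quotm_piP; rewrite reprK.
Qed.

Lemma quotm_piD x y :
  \pi_(quotm)%qT (x + y) = \pi_(quotm)%qT x + \pi_(quotm)%qT y.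
Proof. exact: Quotient.pi_add. Qed.

Fact quotm_scaleA a b x :
  quotm_scale a (quotm_scale b x) = quotm_scale (a * b) x.
Proof. by rewrite -(quotm_reprK x) !quotm_scaleE scalerA. Qed.
Fact quotm_scale1 : left_id 1 quotm_scale.
Proof. by move=> x; rewrite -(quotm_reprK x) quotm_scaleE scale1r. Qed.
Fact quotm_scaleDr : right_distributive quotm_scale +%R.
Proof.
move=> a x y; rewrite -(quotm_reprK x) -(quotm_reprK y) -quotm_piD !quotm_scaleE.
by rewrite -quotm_piD scalerDr.
Qed.
Fact quotm_scaleDl x : {morph quotm_scale^~ x : a b / a + b}.
Proof.
move=> a b; rewrite -(quotm_reprK x) !quotm_scaleE.
by rewrite -quotm_piD scalerDl.
Qed.

HB.instance Definition _ := GRing.Zmodule_isLmodule.Build A quotm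
  quotm_scaleA quotm_scale1 quotm_scaleDr quotm_scaleDl.

End QuotientModule.

Section Ideals.
Variable A : comPzRingType.
Implicit Types (I J : set A).

Definition is_ideal I : Prop := @is_submodule A A^o I.

Definition noetherian : Prop :=
  forall I, is_ideal I -> exists s : seq A, I = @span A A^o [set` s].

Definition is_prime I : Prop :=
  [/\ is_ideal I, ~ I 1 & forall a b, I (a * b) -> I a \/ I b].

Definition radical I : set A := [set a | exists n, I (a ^+ n)].

Definition ideal_add I J : set A := [set a + b | a in I & b in J].

Definition ideal_pow I n : set A := iter n (@smul A A^o I) [set: A].

Record prime_ideal := PrimeIdeal {
  prime_set :> set A;
  prime_idealP : is_prime prime_set
}.

End Ideals.

Definition extension (A B : comPzRingType) (f : A -> B) (I : set A) : set B :=
  @span B B^o (f @` I).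

Definition annihilator (A : comPzRingType) (M : lmodType A) (x : M) : set A :=
  [set a | a *: x = 0].

Definition Ass (A : comPzRingType) (M : lmodType A) : set (set A) :=
  [set p | is_prime p /\ exists x : M, p = annihilator x].

Definition mAss (A : comPzRingType) (M : lmodType A) : set (set A) :=
  [set p | Ass M p /\ forall q, Ass M q -> q `<=` p -> q = p].

Section IdealPowers.
Variables (A : comPzRingType) (I : set A).

Definition powm (M : lmodType A) (n : nat) : set M :=
  smul (ideal_pow I n) [set: M].
Arguments powm M n : clear implicits.

Lemma submoduleT (M : lmodType A) : is_submodule [set: M].
Proof. exact/is_submoduleP. Qed.

Lemma powm_submodule (M : lmodType A) n : is_submodule (powm M n).
Proof. exact: smul_submodule. Qed.

Lemma ideal_pow_ideal n : is_ideal (ideal_pow I n).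
Proof.
by case: n => [|n]; [exact: (submoduleT A^o)|exact: (@smul_submodule A A^o)].
Qed.

Lemma ideal_powM m n a b :
  ideal_pow I m a -> ideal_pow I n b -> ideal_pow I (m + n) (a * b).
Proof.
move=> Ia Ib; elim: m a Ia => [a _|m IHm].
  by have [_ _] := (@is_submoduleP A A^o _).1 (ideal_pow_ideal n); apply.
have [K0 KD KZ] := (@is_submoduleP A A^o _).1 (ideal_pow_ideal (m.+1 + n)).
apply: (@span_ind A A^o _ [set a | ideal_pow I (m.+1 + n) (a * b)]).
  apply/is_submoduleP; split=> /= [|x y Kx Ky|c x Kx]; rewrite ?mul0r //.
    by rewrite mulrDl; apply: KD.
  by rewrite -[(c *: x) * b]/(c * x * b) -mulrA; apply: (KZ c).
move=> _ [c Ic [x Ix <-]] /=; rewrite -[(c *: x) * b]/(c * x * b) -mulrA.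
by apply: sub_gen_smallest; exists c => //; exists (x * b) => //; exact: IHm.
Qed.

Lemma ideal_powS m n : (m <= n)%N -> ideal_pow I n `<=` ideal_pow I m.
Proof.
move=> /subnK <-; elim: (n - m)%N => // k IHk a /=.
by move/(@smul_sub A A^o _ _ (ideal_pow_ideal _))/IHk.
Qed.

Variable M : lmodType A.

Lemma powmS m n : (m <= n)%N -> powm M n `<=` powm M m.
Proof.
move=> mn; apply: span_ind; first exact: powm_submodule.
move=> _ [a Ia [x _ <-]]; apply: sub_gen_smallest.
by exists a; [exact: ideal_powS Ia|exists x].
Qed.

Lemma powm_scale_in m a (x : M) : ideal_pow I m a -> powm M m (a *: x).
Proof. by move=> Ia; apply: sub_gen_smallest; exists a => //; exists x. Qed.

Lemma powm_regular n : powm A^o n `<=` ideal_pow I n.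
Proof.
apply: (@span_ind A A^o); first exact: ideal_pow_ideal.
move=> _ [a Ia [x _ <-]].
have [_ _] := (@is_submoduleP A A^o _).1 (ideal_pow_ideal n).
by rewrite [a *: _]mulrC; apply.
Qed.

Lemma powm_scale m n (a : A^o) (x : M) :
  powm A^o m a -> powm M n x -> powm M (m + n) ((a : A) *: x).
Proof.
move=> /powm_regular Ia.
have [K0 KD KZ] := (is_submoduleP _).1 (powm_submodule M (m + n)).
apply: (@span_ind A M _ [set x | powm M (m + n) ((a : A) *: x)]).
  apply/is_submoduleP; split=> /= [|y z Ky Kz|c y Ky]; rewrite ?scaler0 //.
    by rewrite scalerDr; apply: KD.
  by rewrite scalerA mulrC -scalerA; apply: KZ.
move=> _ [b Ib [y _ <-]] /=; rewrite scalerA.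
by apply: powm_scale_in; exact: ideal_powM.
Qed.

Lemma powm0 : powm M 0 = [set: M].
Proof.
apply/seteqP; split=> // x _; rewrite -[x]scale1r.
exact: powm_scale_in.
Qed.

End IdealPowers.
Arguments powm {A} I M n.


Record mul_set (A : comPzRingType) := MulSet {
  mul_set_set :> set A;
  mul_set1 : mul_set_set 1;
  mul_setM : forall s t, mul_set_set s -> mul_set_set t -> mul_set_set (s * t)
}.

Section Fractions.
Variables (A : comPzRingType) (S : mul_set A).

Record denom := Denom { den : A; denP : (S : set A) den }.
HB.instance Definition _ := gen_eqMixin denom.
HB.instance Definition _ := gen_choiceMixin denom.

Definition denom1 : denom := Denom (mul_set1 S).
Definition denomM (s t : denom) : denom := Denom (mul_setM (denP s) (denP t)).

Section Additive.
Variable M : lmodType A.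

(* the pair (x, s) stands for the fraction x / s *)
Definition frac_equiv (x y : M * denom) : bool :=
  `[< exists t : denom, den t *: (den y.2 *: x.1) = den t *: (den x.2 *: y.1) >].

Fact frac_equiv_is_equiv : equiv_class_of frac_equiv.
Proof.
split=> [x|x y|y x z].
- by apply/asboolP; exists denom1.
- by apply/asboolP/asboolP => -[t /esym xy]; exists t.
- move=> /asboolP[t xy] /asboolP[u yz]; apply/asboolP.
  exists (denomM (denomM t u) y.2) => /=.
  have -> : (den t * den u * den y.2) *: (den z.2 *: x.1) =
      (den u * den z.2) *: (den t *: (den y.2 *: x.1)).
    by rewrite !scalerA; congr (_ *: _); ring.
  rewrite xy.
  have -> : (den u * den z.2) *: (den t *: (den x.2 *: y.1)) =
      (den t * den x.2) *: (den u *: (den z.2 *: y.1)).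
    by rewrite !scalerA; congr (_ *: _); ring.
  by rewrite yz !scalerA; congr (_ *: _); ring.
Qed.

Canonical frac_equiv_equiv := EquivRelPack frac_equiv_is_equiv.
Canonical frac_equiv_encModRel := defaultEncModRel frac_equiv.

Definition frac : Type := {eq_quot frac_equiv}%qT.
HB.instance Definition _ := Choice.on frac.
HB.instance Definition _ := EqQuotient.on frac.

Definition mk_frac (x : M) (s : denom) : frac := \pi_(frac)%qT (x, s).

Lemma mk_fracP x s y t : mk_frac x s = mk_frac y t <->
  exists u : denom, den u *: (den t *: x) = den u *: (den s *: y).
Proof.
split=> [/eqmodP/asboolP //|E].
by apply/eqmodP/asboolP.
Qed.

Lemma mk_frac_repr (x : frac) : x = mk_frac (repr x).1 (repr x).2.
Proof. by rewrite /mk_frac -surjective_pairing reprK. Qed.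

Lemma fracW (P : frac -> Prop) :
  (forall x s, P (mk_frac x s)) -> forall z, P z.
Proof. by move=> Pxs z; rewrite (mk_frac_repr z). Qed.

Lemma mk_frac_reprP x s : exists u : denom,
  den u *: (den s *: (repr (mk_frac x s)).1) =
  den u *: (den (repr (mk_frac x s)).2 *: x).
Proof. by apply/mk_fracP; rewrite -mk_frac_repr. Qed.

Definition frac_add (x y : frac) : frac :=
  mk_frac (den (repr y).2 *: (repr x).1 + den (repr x).2 *: (repr y).1)
          (denomM (repr x).2 (repr y).2).
Definition frac_opp (x : frac) : frac := mk_frac (- (repr x).1) (repr x).2.
Definition frac_zero : frac := mk_frac 0 denom1.

Lemma frac_addE x s y t : frac_add (mk_frac x s) (mk_frac y t) =
  mk_frac (den t *: x + den s *: y) (denomM s t).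
Proof.
rewrite /frac_add; have [u] := mk_frac_reprP x s.
have [v] := mk_frac_reprP y t.
case: (repr _) => /= y' t' Hy; case: (repr _) => /= x' s' Hx.
apply/mk_fracP; exists (denomM u v) => /=; rewrite !scalerDr; congr (_ + _).
  have -> : (den u * den v) *: (den s * den t *: (den t' *: x')) =
     (den v * den t * den t') *: (den u *: (den s *: x')).
    by rewrite !scalerA; congr (_ *: _); ring.
  by rewrite Hx !scalerA; congr (_ *: _); ring.
have -> : (den u * den v) *: (den s * den t *: (den s' *: y')) =
     (den u * den s * den s') *: (den v *: (den t *: y')).
  by rewrite !scalerA; congr (_ *: _); ring.
by rewrite Hy !scalerA; congr (_ *: _); ring.
Qed.

Lemma frac_oppE x s : frac_opp (mk_frac x s) = mk_frac (- x) s.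
Proof.
rewrite /frac_opp; have [u] := mk_frac_reprP x s.
case: (repr _) => /= x' s' Hx; apply/mk_fracP; exists u.
by rewrite !scalerN Hx.
Qed.

Lemma mk_frac_eq x s y t : den t *: x = den s *: y -> mk_frac x s = mk_frac y t.
Proof. by move=> E; apply/mk_fracP; exists denom1; rewrite E. Qed.

Fact frac_addA : associative frac_add.
Proof.
move=> x y z; elim/fracW: x => x s; elim/fracW: y => y t; elim/fracW: z => z r.
rewrite !frac_addE; apply: mk_frac_eq => /=.
by rewrite !scalerDr !scalerA !addrA; congr (_ *: _ + _ *: _ + _ *: _); ring.
Qed.
Fact frac_addC : commutative frac_add.
Proof.
move=> x y; elim/fracW: x => x s; elim/fracW: y => y t; rewrite !frac_addE.
apply: mk_frac_eq => /=.
by rewrite addrC !scalerDr !scalerA; congr (_ *: _ + _ *: _); ring.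
Qed.
Fact frac_add0 : left_id frac_zero frac_add.
Proof.
move=> x; elim/fracW: x => x s; rewrite frac_addE; apply: mk_frac_eq => /=.
by rewrite scaler0 add0r scale1r mul1r.
Qed.
Fact frac_addN : left_inverse frac_zero frac_opp frac_add.
Proof.
move=> x; elim/fracW: x => x s; rewrite frac_oppE frac_addE; apply: mk_frac_eq => /=.
by rewrite scalerN addNr !scaler0.
Qed.

HB.instance Definition _ :=
  GRing.isZmodule.Build frac frac_addA frac_addC frac_add0 frac_addN.

Lemma mk_fracD x s y t : mk_frac x s + mk_frac y t =
  mk_frac (den t *: x + den s *: y) (denomM s t).
Proof. exact: frac_addE. Qed.

End Additive.

Definition frac_scale (M : lmodType A) (a : frac A^o) (x : frac M) : frac M :=
  mk_frac (((repr a).1 : A) *: (repr x).1) (denomM (repr a).2 (repr x).2).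

Lemma frac_scaleE (M : lmodType A) (a : A^o) s (x : M) t :
  frac_scale (mk_frac a s) (mk_frac x t) = mk_frac ((a : A) *: x) (denomM s t).
Proof.
rewrite /frac_scale; have [u] := mk_frac_reprP a s.
have [v] := mk_frac_reprP x t.
case: (repr _) => /= x' t' Hx; case: (repr _) => /= a' s' Ha.
apply/mk_fracP; exists (denomM u v) => /=.
have {}Ha : den u * (den s * a') = den u * (den s' * a) by exact: Ha.
have -> : (den u * den v) *: (den s * den t *: ((a' : A) *: x')) =
    (den u * (den s * a')) *: (den v *: (den t *: x')).
  by rewrite !scalerA; congr (_ *: _); ring.
by rewrite Ha Hx !scalerA; congr (_ *: _); ring.
Qed.

(* S^-1 A is S^-1 M for M = A^o, with frac_scale as its product; the completion
   and the extended Rees ring below are obtained from modules in the same way. *)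
Definition frac_ring : Type := frac A^o.
HB.instance Definition _ := GRing.Zmodule.on frac_ring.
HB.instance Definition _ := EqQuotient.on frac_ring.

Section Scale.
Variable M : lmodType A.
Implicit Types (a b : frac A^o) (x y : frac M).

Fact frac_scaleA a b x :
  frac_scale a (frac_scale b x) = frac_scale (frac_scale a b) x.
Proof.
elim/fracW: a => a d; elim/fracW: b => b e; elim/fracW: x => x s.
rewrite (frac_scaleE b) (frac_scaleE a d b) !frac_scaleE.
by apply: mk_frac_eq => /=; rewrite scale_regularE !scalerA; congr (_ *: _); ring.
Qed.
Fact frac_scale1 : left_id (mk_frac (1 : A^o) denom1) (@frac_scale M).
Proof.
move=> x; elim/fracW: x => x s; rewrite frac_scaleE; apply: mk_frac_eq => /=.
by rewrite scale1r mul1r.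
Qed.
Fact frac_scaleDr : right_distributive (@frac_scale M) +%R.
Proof.
move=> a x y; elim/fracW: a => a d; elim/fracW: x => x s; elim/fracW: y => y t.
rewrite mk_fracD !frac_scaleE mk_fracD; apply: mk_frac_eq => /=.
by rewrite !scalerDr !scalerA; congr (_ *: _ + _ *: _); ring.
Qed.
Fact frac_scaleDl x : {morph (@frac_scale M)^~ x : a b / a + b}.
Proof.
move=> a b; elim/fracW: a => a d; elim/fracW: b => b e; elim/fracW: x => x s.
rewrite mk_fracD !frac_scaleE mk_fracD; apply: mk_frac_eq => /=.
rewrite !scale_regularE scalerA !scalerDr !scalerA -scalerDl; congr (_ *: _).
by ring.
Qed.
End Scale.

Fact frac_mulC : commutative (@frac_scale A^o).
Proof.
move=> a b; elim/fracW: a => a d; elim/fracW: b => b e; rewrite !frac_scaleE.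
by apply: mk_frac_eq => /=; rewrite !scale_regularE; ring.
Qed.

HB.instance Definition _ := GRing.Zmodule_isComPzRing.Build frac_ring
  (@frac_scaleA A^o) frac_mulC (@frac_scale1 A^o)
  (fun a b c => @frac_scaleDl A^o c a b).

HB.instance Definition _ (M : lmodType A) :=
  GRing.Zmodule_isLmodule.Build frac_ring (frac M)
  (@frac_scaleA M) (@frac_scale1 M) (@frac_scaleDr M) (@frac_scaleDl M).

Definition to_frac (a : A) : frac_ring := @mk_frac A^o a denom1.

End Fractions.

(* The J-adic completion of M: Cauchy sequences modulo null sequences. *)
Section Completion.
Variables (A : comPzRingType) (J : set A).

Section Additive.
Variable M : lmodType A.

Definition cauchy (x : nat -> M) : Prop := forall k, exists m,
  forall i j, (m <= i)%N -> (m <= j)%N -> powm J M k (x i - x j).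

Definition null (x : nat -> M) : Prop := forall k, exists m,
  forall i, (m <= i)%N -> powm J M k (x i).

Definition cauchy_pred : {pred nat -> M} := fun x => `[< cauchy x >].

Fact cauchy_zmod_closed : zmod_closed cauchy_pred.
Proof.
split=> [|x y /asboolP cx /asboolP cy]; apply/asboolP => k.
  exists 0%N => i j _ _; rewrite subrr.
  by have [] := (is_submoduleP _).1 (powm_submodule J M k).
have [m mx] := cx k; have [n ny] := cy k; exists (maxn m n) => i j.
rewrite !geq_max => /andP[mi ni] /andP[mj nj].
have -> : (x - y) i - (x - y) j = (x i - x j) - (y i - y j).
  by rewrite -[(x - y) i]/(x i - y i) -[(x - y) j]/(x j - y j) !opprD addrACA.
by apply: (submoduleB (powm_submodule J M k)); [exact: mx|exact: ny].
Qed.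

HB.instance Definition _ :=
  GRing.isZmodClosed.Build (nat -> M) cauchy_pred cauchy_zmod_closed.

Record cauchy_seq := CauchySeq {
  cauchy_val :> nat -> M;
  cauchy_valP : cauchy_val \in cauchy_pred
}.
HB.instance Definition _ := [isSub for cauchy_val].
HB.instance Definition _ := [Choice of cauchy_seq by <:].
HB.instance Definition _ := [SubChoice_isSubZmodule of cauchy_seq by <:].

Lemma cauchy_seqP (x : cauchy_seq) : cauchy x.
Proof. by apply/asboolP; exact: cauchy_valP. Qed.

Definition mk_cauchy (x : nat -> M) (cx : cauchy x) : cauchy_seq :=
  CauchySeq (asboolT cx).

Lemma cauchy_seq_eq (x y : cauchy_seq) : x =1 y -> x = y.
Proof. by move=> xy; apply: val_inj; apply/funext. Qed.

Definition null_pred : {pred cauchy_seq} := fun x => `[< null x >].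

Fact null_zmod_closed : zmod_closed null_pred.
Proof.
split=> [|x y /asboolP cx /asboolP cy]; apply/asboolP => k.
  exists 0%N => i _.
  by have [] := (is_submoduleP _).1 (powm_submodule J M k).
have [m mx] := cx k; have [n ny] := cy k; exists (maxn m n) => i.
rewrite geq_max => /andP[mi ni].
by apply: (submoduleB (powm_submodule J M k)); [exact: mx|exact: ny].
Qed.

HB.instance Definition _ :=
  GRing.isZmodClosed.Build cauchy_seq null_pred null_zmod_closed.

Definition completion : Type := Quotient.quot null_pred.
HB.instance Definition _ := GRing.Zmodule.on completion.
HB.instance Definition _ := EqQuotient.on completion.

Definition cauchy_lim (x : cauchy_seq) : completion := \pi_(completion)%qT x.

Lemma cauchy_limP x y : cauchy_lim x = cauchy_lim y <-> null (x - y).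
Proof.
split=> [/eqP|nxy]; last by apply/eqP; rewrite -Quotient.idealrBE; exact/asboolP.
by rewrite -Quotient.idealrBE => /asboolP.
Qed.

Lemma cauchy_limW (P : completion -> Prop) :
  (forall x, P (cauchy_lim x)) -> forall z, P z.
Proof. by move=> Px z; rewrite -[z]reprK; exact: Px. Qed.

Lemma cauchy_limD x y : cauchy_lim (x + y) = cauchy_lim x + cauchy_lim y.
Proof. exact: Quotient.pi_add. Qed.

Lemma cauchy_cst (x : M) : cauchy (fun=> x).
Proof.
move=> k; exists 0%N => i j _ _; rewrite subrr.
by have [] := (is_submoduleP _).1 (powm_submodule J M k).
Qed.

Definition to_completion (x : M) : completion :=
  cauchy_lim (mk_cauchy (cauchy_cst x)).

End Additive.

Section SeqScale.
Variable M : lmodType A.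

Fact cauchy_scale (a : cauchy_seq A^o) (x : cauchy_seq M) :
  cauchy (fun i => (a i : A) *: x i).
Proof.
move=> k; have [m ma] := cauchy_seqP a k; have [n nx] := cauchy_seqP x k.
exists (maxn m n) => i j.
rewrite !geq_max => /andP[mi ni] /andP[mj nj].
have -> : (a i : A) *: x i - (a j : A) *: x j =
   (a i : A) *: (x i - x j) + (a i - a j : A) *: x j.
  by rewrite scalerBr scalerBl addrA subrK.
have [_ PD PZ] := (is_submoduleP _).1 (powm_submodule J M k).
apply: PD; first by apply: PZ; exact: nx.
by apply: powm_scale_in; apply: powm_regular; exact: ma.
Qed.

Definition seq_scale (a : cauchy_seq A^o) (x : cauchy_seq M) : cauchy_seq M :=
  mk_cauchy (cauchy_scale a x).

Definition completion_scale (a : completion A^o) (x : completion M) :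
  completion M := cauchy_lim (seq_scale (repr a) (repr x)).

Lemma completion_scaleE a x :
  completion_scale (cauchy_lim a) (cauchy_lim x) = cauchy_lim (seq_scale a x).
Proof.
rewrite /completion_scale.
set b := repr _; set y := repr _; apply/cauchy_limP => k.
have /cauchy_limP/(_ k)[m ab] : cauchy_lim b = cauchy_lim a by exact: reprK.
have /cauchy_limP/(_ k)[n xy] : cauchy_lim y = cauchy_lim x by exact: reprK.
exists (maxn m n) => i; rewrite geq_max => /andP[/ab {}ab /xy {}xy].
change (powm J M k ((b i : A) *: y i - (a i : A) *: x i)).
have -> : (b i : A) *: y i - (a i : A) *: x i =
   (b i : A) *: (y i - x i) + (b i - a i : A) *: x i.
  by rewrite scalerBr scalerBl addrA subrK.
have [_ PD PZ] := (is_submoduleP _).1 (powm_submodule J M k).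
by apply: PD; [exact: PZ|apply: powm_scale_in; exact: powm_regular].
Qed.

End SeqScale.

Definition completion_ring : Type := completion A^o.
HB.instance Definition _ := GRing.Zmodule.on completion_ring.
HB.instance Definition _ := EqQuotient.on completion_ring.

Section Scale.
Variable M : lmodType A.
Implicit Types (a b : completion A^o) (x y : completion M).

Fact completion_scaleA a b x :
  completion_scale a (completion_scale b x) =
  completion_scale (completion_scale a b) x.
Proof.
elim/cauchy_limW: a => a; elim/cauchy_limW: b => b; elim/cauchy_limW: x => x.
rewrite !completion_scaleE; congr cauchy_lim.
by apply: cauchy_seq_eq => i /=; rewrite scalerA.
Qed.
Fact completion_scale1 :
  left_id (to_completion (1 : A^o)) (@completion_scale M).
Proof.
move=> x; elim/cauchy_limW: x => x; rewrite completion_scaleE; congr cauchy_lim.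
by apply: cauchy_seq_eq => i /=; rewrite scale1r.
Qed.
Fact completion_scaleDr : right_distributive (@completion_scale M) +%R.
Proof.
move=> a x y; elim/cauchy_limW: a => a.
elim/cauchy_limW: x => x; elim/cauchy_limW: y => y.
rewrite -cauchy_limD !completion_scaleE -cauchy_limD; congr cauchy_lim.
by apply: cauchy_seq_eq => i /=; rewrite scalerDr.
Qed.
Fact completion_scaleDl x : {morph (@completion_scale M)^~ x : a b / a + b}.
Proof.
move=> a b; elim/cauchy_limW: a => a.
elim/cauchy_limW: b => b; elim/cauchy_limW: x => x.
rewrite -cauchy_limD !completion_scaleE -cauchy_limD; congr cauchy_lim.
by apply: cauchy_seq_eq => i /=; rewrite scalerDl.
Qed.
End Scale.

Fact completion_mulC : commutative (@completion_scale A^o).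
Proof.
move=> a b; elim/cauchy_limW: a => a; elim/cauchy_limW: b => b.
rewrite !completion_scaleE; congr cauchy_lim.
by apply: cauchy_seq_eq => i /=; exact: mulrC.
Qed.

HB.instance Definition _ := GRing.Zmodule_isComPzRing.Build completion_ring
  (@completion_scaleA A^o) completion_mulC (@completion_scale1 A^o)
  (fun a b c => @completion_scaleDl A^o c a b).

HB.instance Definition _ (M : lmodType A) :=
  GRing.Zmodule_isLmodule.Build completion_ring (completion M)
  (@completion_scaleA M) (@completion_scale1 M)
  (@completion_scaleDr M) (@completion_scaleDl M).

Definition to_completion_ring (a : A) : completion_ring :=
  @to_completion A^o a.

End Completion.

(* The extended Rees module of M: a finitely supported family f with
   f n \in I^n M stands for the Laurent polynomial \sum_n f_n t^n. *)
Section Rees.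
Variables (R : comPzRingType) (I : set R).

(* I^n M, with I^n = R for n <= 0 *)
Definition powmz (M : lmodType R) (n : int) : set M :=
  if n is Posz k then powm I M k else [set: M].
Arguments powmz M n : clear implicits.

Lemma powmz_submodule M n : is_submodule (powmz M n).
Proof. by case: n => n; [exact: powm_submodule|exact: submoduleT]. Qed.

Let nneg (n : int) : nat := if n is Posz k then k else 0.

Lemma powmzE M n : powmz M n = powm I M (nneg n).
Proof. by case: n => n //=; rewrite powm0. Qed.

Lemma powmz_scale (M : lmodType R) i j (a : R^o) (x : M) :
  powmz R^o i a -> powmz M j x -> powmz M (i + j) ((a : R) *: x).
Proof.
rewrite !powmzE => Ia Ix; apply: (@powmS _ _ _ _ (nneg i + nneg j)).
  have nnegE n : (n <= nneg n)%R /\ (nneg n = 0%N \/ nneg n = n :> int).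
    by case: n => n /=; split; [lia|right|lia|left].
  by have [? ?] := nnegE i; have [? ?] := nnegE j;
     have [? ?] := nnegE (i + j)%R; lia.
exact: powm_scale.
Qed.

Section Additive.
Variable M : lmodType R.

Definition rees_pred : {pred int -> M} := fun f =>
  `[< finite_set [set n | f n != 0] /\ forall n, powmz M n (f n) >].

Fact rees_zmod_closed : zmod_closed rees_pred.
Proof.
split=> [|f g /asboolP[ff If] /asboolP[fg Ig]]; apply/asboolP;
  (split; last move=> n).
- rewrite (_ : [set n | _] = set0) //; apply/seteqP; split=> n //=.
  by rewrite eqxx.
- by have [] := (is_submoduleP _).1 (powmz_submodule M n).
- apply: (@sub_finite_set _ _ ([set n | f n != 0] `|` [set n | g n != 0])).
    move=> n /= fgn; have [fn|] := eqVneq (f n) 0; last by left.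
    right; apply: contraNneq fgn => gn.
    by rewrite -[(f - g) n]/(f n - g n) fn gn subrr.
  by rewrite finite_setU.
- by apply: (submoduleB (powmz_submodule M n)).
Qed.

HB.instance Definition _ :=
  GRing.isZmodClosed.Build (int -> M) rees_pred rees_zmod_closed.

Record rees := Rees { coefr :> int -> M; rees_valP : coefr \in rees_pred }.
HB.instance Definition _ := [isSub for coefr].
HB.instance Definition _ := [Choice of rees by <:].
HB.instance Definition _ := [SubChoice_isSubZmodule of rees by <:].

Lemma reesP (f : rees) :
  finite_set [set n | f n != 0] /\ forall n, powmz M n (f n).
Proof. by apply/asboolP; exact: rees_valP. Qed.

Lemma rees_eq (f g : rees) : f =1 g -> f = g.
Proof. by move=> fg; apply: val_inj; apply/funext. Qed.

Definition supp (f : rees) : {fset int} := fset_set [set n | f n != 0].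

Lemma suppPn (f : rees) n : n \notin supp f -> f n = 0.
Proof.
rewrite in_fset_set; last by case: (reesP f).
by move=> /negP nf; apply/eqP/negP => /negP fn; apply: nf; exact: mem_set.
Qed.

(* x t^n *)
Fact monom_subproof (n : int) (x : M) (Ix : powmz M n x) :
  (fun m => if m == n then x else 0) \in rees_pred.
Proof.
apply/asboolP; split=> [|m].
  by apply: (@sub_finite_set _ _ [set n]) => // m /=; case: (m =P n); rewrite ?eqxx.
case: eqP => [->//|_].
by have [] := (is_submoduleP _).1 (powmz_submodule M m).
Qed.

Definition monom (n : int) (x : M) (Ix : powmz M n x) : rees :=
  Rees (monom_subproof Ix).

End Additive.

Section Convolution.
Variable M : lmodType R.

Definition conv (a : rees R^o) (x : rees M) (n : int) : M :=
  \sum_(i \in [set: int]) (a i : R) *: x (n - i).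

Lemma convE (D : {fset int}) a x n :
  (supp a `<=` D)%fset -> conv a x n = \sum_(i <- D) (a i : R) *: x (n - i).
Proof.
move=> aD; apply: fsbigTE => i iD; rewrite suppPn ?scale0r //.
by apply: contra iD; move/fsubsetP: aD; apply.
Qed.

Fact conv_rees a x : conv a x \in @rees_pred M.
Proof.
apply/asboolP; split=> [|n].
  apply: (@sub_finite_set _ _
      [set` [fset (i + j)%R | i in supp a, j in supp x]%fset]) => // n /= axn.
  apply: contraNT axn => nD; apply/eqP; rewrite (convE _ _ (fsubset_refl _)).
  apply: big1_seq => i /= ia; rewrite [x _]suppPn ?scaler0 //.
  apply: contra nD => nix; apply/imfset2P; exists i => //.
  by exists (n - i) => //; rewrite addrC subrK.
rewrite (convE _ _ (fsubset_refl _)).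
have [P0 PD _] := (is_submoduleP _).1 (powmz_submodule M n).
elim/big_ind: _ => // i _; rewrite -[n in powmz M n](subrK i) addrC.
by apply: powmz_scale; [case: (reesP a)|case: (reesP x)].
Qed.

Definition rees_scale (a : rees R^o) (x : rees M) : rees M :=
  Rees (conv_rees a x).

Lemma rees_scaleE (D : {fset int}) a x n : (supp a `<=` D)%fset ->
  rees_scale a x n = \sum_(i <- D) (a i : R) *: x (n - i).
Proof. exact: convE. Qed.

End Convolution.

Fact powmz_regular0 (a : R) : powmz R^o 0 a.
Proof. by rewrite powmzE powm0. Qed.

Section Scale.
Variable M : lmodType R.
Implicit Types (a b : rees R^o) (x y : rees M).

Fact rees_scaleA a b x :
  rees_scale a (rees_scale b x) = rees_scale (rees_scale a b) x.
Proof.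
apply: rees_eq => n.
set D := (supp (rees_scale a b) `|`
          [fset (i + j)%R | i in supp a, j in supp b])%fset.
rewrite (rees_scaleE _ _ (fsubset_refl _)) (@rees_scaleE _ D) ?fsubsetUl //.
under [RHS]eq_bigr => k _.
  rewrite (rees_scaleE _ _ (fsubset_refl _)) scaler_suml.
  under eq_bigr do rewrite scale_regularE -scalerA.
  over.
rewrite exchange_big /=; apply: eq_big_seq => i ia; rewrite -scaler_sumr.
congr (_ *: _); rewrite -[LHS]/(conv b x (n - i)) /conv.
rewrite (@reindex_fsbigT _ _ _ int int (fun k => k - i)); last first.
  by exists (fun k => k + i) => k; rewrite ?subrK ?addrK.
rewrite (@fsbigTE _ _ _ _ D) => [|k kD].
  by apply: eq_bigr => k _; rewrite opprB addrA subrK.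
rewrite [b _]suppPn ?scale0r //; apply: contra kD => kb.
rewrite in_fsetU; apply/orP; right.
by apply/imfset2P; exists i => //; exists (k - i) => //; rewrite addrC subrK.
Qed.

Fact rees_scale1 : left_id (monom (powmz_regular0 1)) (@rees_scale M).
Proof.
move=> x; apply: rees_eq => n; rewrite (@rees_scaleE _ [fset 0%R]%fset).
  by rewrite big_seq_fset1 /= ?eqxx scale1r subr0.
apply/fsubsetP => m; rewrite in_fset_set; last first.
  by case: (reesP (monom (powmz_regular0 1))).
by move=> /set_mem /=; case: (m =P 0) => [->|]; rewrite ?inE ?eqxx.
Qed.

Fact rees_scaleDr : right_distributive (@rees_scale M) +%R.
Proof.
move=> a x y; apply: rees_eq => n.
transitivity (rees_scale a x n + rees_scale a y n) => //.
rewrite !(rees_scaleE _ _ (fsubset_refl _)) -big_split /=.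
by apply: eq_bigr => i _; rewrite -scalerDr.
Qed.

Fact rees_scaleDl x : {morph (@rees_scale M)^~ x : a b / a + b}.
Proof.
move=> a b; apply: rees_eq => n.
transitivity (rees_scale a x n + rees_scale b x n) => //.
set D := (supp (a + b)%R `|` (supp a `|` supp b))%fset.
rewrite !(@rees_scaleE _ D).
- rewrite -big_split /=; apply: eq_bigr => i _; rewrite -scalerDl.
  by congr (_ *: _).
- by rewrite /D fsetUA [(_ `|` supp a)%fset]fsetUC fsubsetUr.
- by rewrite /D fsetUCA fsubsetUl.
- by rewrite fsubsetUl.
Qed.
End Scale.

Fact rees_mulC : commutative (@rees_scale R^o).
Proof.
move=> a b; apply: rees_eq => n; rewrite /= /conv.
rewrite (@reindex_fsbigT _ _ _ int int (fun k => n - k)); last first.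
  by exists (fun k => n - k) => k; rewrite subKr.
by apply: eq_fsbigr => k _; rewrite subKr !scale_regularE mulrC.
Qed.

Definition rees_ring : Type := rees R^o.
HB.instance Definition _ := GRing.Zmodule.on rees_ring.

HB.instance Definition _ := GRing.Zmodule_isComPzRing.Build rees_ring
  (@rees_scaleA R^o) rees_mulC (@rees_scale1 R^o)
  (fun a b c => @rees_scaleDl R^o c a b).

HB.instance Definition _ (M : lmodType R) :=
  GRing.Zmodule_isLmodule.Build rees_ring (rees M)
  (@rees_scaleA M) (@rees_scale1 M) (@rees_scaleDr M) (@rees_scaleDl M).

Definition rees_cst (a : R) : rees_ring := monom (powmz_regular0 a).

(* u = t^-1 *)
Definition rees_u : rees_ring :=
  @monom R^o (-1) 1 (Logic.I : powmz R^o (-1) 1).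

End Rees.
Arguments powmz {R} I M n.
Arguments rees {R} I M.
Arguments rees_ring {R} I.
Arguments rees_cst {R} I a.
Arguments rees_u {R} I.

Section QuintessentialPrimes.
Variable A : comPzRingType.

Fact prime_compl1 (p : prime_ideal A) : (~` (p : set A)) 1.
Proof. by case: (prime_idealP p). Qed.

Fact prime_complM (p : prime_ideal A) s t :
  (~` (p : set A)) s -> (~` (p : set A)) t -> (~` (p : set A)) (s * t).
Proof. by case: (prime_idealP p) => _ _ pM ps pt /pM[]. Qed.

Definition prime_compl (p : prime_ideal A) : mul_set A :=
  MulSet (@prime_compl1 p) (@prime_complM p).

Definition loc_ring (p : prime_ideal A) : comPzRingType :=
  frac_ring (prime_compl p).
Definition loc_mod (p : prime_ideal A) (M : lmodType A) :
  lmodType (loc_ring p) := frac (prime_compl p) M.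

Definition loc_max (p : prime_ideal A) : set (loc_ring p) :=
  extension (@to_frac A (prime_compl p)) p.

(* completions for the p A_p-adic topology, p A_p being loc_max *)
Definition hat_ring (p : prime_ideal A) : comPzRingType :=
  completion_ring (@loc_max p).
Definition hat_mod (p : prime_ideal A) (M : lmodType A) :
  lmodType (hat_ring p) := completion (@loc_max p) (loc_mod p M).

Definition to_hat (p : prime_ideal A) (a : A) : hat_ring p :=
  to_completion_ring (@loc_max p) (to_frac (prime_compl p) a).

Definition quint_primes (J : set A) (M : lmodType A) : set (set A) :=
  [set p : set A | exists2 P : prime_ideal A, p = (P : set A) &
     exists2 q, Ass (hat_mod P M) q &
       radical (ideal_add (extension (@to_hat P) J) q) =
       extension (@to_hat P) P].

End QuintessentialPrimes.

Definition ess_primes (R : comPzRingType) (I : set R) (N : lmodType R) :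
    set (set R) :=
  [set rees_cst I @^-1` q |
     q in quint_primes (@span (rees_ring I) (rees_ring I)^o [set rees_u I])
                       (rees I N)].

Section SymbolicPowers.
Variables (R : comPzRingType) (I : set R) (N : lmodType R).

Definition mod_IN : lmodType R := quotm (smulm I [set: N]).

Definition symb_denom : set R := ~` \bigcup_(p in mAss mod_IN) p.

(* (IN)^(n) *)
Definition symb_pow (n : nat) : set N :=
  \bigcup_(s in symb_denom) [set x | powm I N n (s *: x)].

End SymbolicPowers.
Arguments symb_pow {R} I N n.

(* Main.v *)
(* Let T_k be the set of x in N[It,u] with s x in u^k N[It,u] for some s in S.
   As u is regular on N[It,u], the inclusion of a single T_k in u N[It,u] gives
   T_(n+k) <= u^n N[It,u] for all n, which is the theorem in degree 0.

   If no T_k lies in u N[It,u], write u N[It,u] as a finite intersection of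
   primary submodules and choose, among those containing no T_k, one whose
   radical p is minimal.  Then p meets S, hence is not quintessential.
   Chevalley's argument in the completion of the localization at p yields a
   nonzero xi in the closure of every T_k.  As p is not quintessential, some
   prime w of the completed ring contains u and an associated prime of xi, but
   not p.  By minimality of p every component whose radical is contained in w
   contains some T_k, and the other ones are killed by powers of elements
   outside w; so c T_k <= u N[It,u] for some c outside w.  Hence
   c^l T_(l+k) <= u^l N[It,u], so c^l xi is divisible by u^l for all l, and
   Krull's intersection theorem at w gives an element outside w that kills xi:
   a contradiction. *)

Require Import Defs.
From mathcomp Require Import all_boot all_order all_algebra ring zify.
From mathcomp Require Import finmap all_classical.
(* [all_algebra] shadows [span]. *)
Import Defs.

Set Implicit Arguments.
Unset Strict Implicit.
Unset Printing Implicit Defensive.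

Import GRing.Theory.

Local Open Scope classical_set_scope.
Local Open Scope ring_scope.

(** * Dependent choice, ideals, spans and sums of submodules *)

Lemma dep_choice (X : Type) (r : X -> X -> Prop) (x0 : X) :
  (forall x, exists y, r x y) ->
  exists f : nat -> X, f 0%N = x0 /\ forall n, r (f n) (f n.+1).
Proof.
move=> /choice[g rg]; by exists (fun n => iter n g x0); split=> // n; exact: rg.
Qed.

Lemma chain_le (T : Type) (J : nat -> set T) :
  (forall n, J n `<=` J n.+1) ->
  forall m n, (m <= n)%N -> J m `<=` J n.
Proof.
move=> J_S m n /subnK <-; elim: (n - m)%N => // k IHk x /IHk.
exact: J_S.
Qed.

Section Ideal.
Variables (A : comPzRingType) (J : set A).
Hypothesis idJ : is_ideal J.

Lemma ideal0 : J 0.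
Proof. by case/(@is_submoduleP A A^o): idJ. Qed.

Lemma idealD a b : J a -> J b -> J (a + b).
Proof. by case/(@is_submoduleP A A^o): idJ => _ JD _; exact: JD. Qed.

Lemma idealMl a b : J b -> J (a * b).
Proof. by case/(@is_submoduleP A A^o): idJ => _ _ JZ; exact: JZ. Qed.

Lemma idealMr a b : J a -> J (a * b).
Proof. by rewrite mulrC; exact: idealMl. Qed.

Lemma idealB a b : J a -> J b -> J (a - b).
Proof. exact: (@submoduleB A A^o). Qed.

End Ideal.

Section Span.
Variables (A : comPzRingType) (M : lmodType A).
Implicit Types (P X : set M) (J : set A).

Lemma submodule0 P : is_submodule P -> P 0.
Proof. by case/is_submoduleP. Qed.

Lemma submoduleD P x y : is_submodule P -> P x -> P y -> P (x + y).
Proof. by case/is_submoduleP => _ PD _; exact: PD. Qed.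

Lemma submoduleZ P a x : is_submodule P -> P x -> P (a *: x).
Proof. by case/is_submoduleP => _ _; exact. Qed.

Lemma submodule_sum P (I : Type) (r : seq I) (Q : pred I) (f : I -> M) :
  is_submodule P -> (forall i, Q i -> P (f i)) -> P (\sum_(i <- r | Q i) f i).
Proof.
move=> PP Pf; elim/big_ind: _ => //; first exact: submodule0.
by move=> x y; exact: submoduleD.
Qed.

Lemma span_mem X x : X x -> span X x.
Proof. by move=> Xx; exact: sub_gen_smallest. Qed.

Lemma span_id P : is_submodule P -> span P = P.
Proof.
move=> PP; apply/seteqP; split; first exact: span_ind.
by move=> x; exact: span_mem.
Qed.

Lemma span_mono X Y : X `<=` Y -> span X `<=` span Y.
Proof.
move=> XY; apply: span_ind; first exact: span_submodule.
by move=> x /XY; exact: span_mem.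
Qed.

Definition sumset P Q : set M := [set x + y | x in P & y in Q].

Lemma sumset_submodule P Q :
  is_submodule P -> is_submodule Q -> is_submodule (sumset P Q).
Proof.
move=> PP PQ; apply/is_submoduleP; split.
- by exists 0; [exact: submodule0|exists 0; [exact: submodule0|rewrite addr0]].
- move=> _ _ [x Px [y Qy <-]] [x' Px' [y' Qy' <-]].
  exists (x + x'); first exact: submoduleD.
  by exists (y + y'); [exact: submoduleD|rewrite addrACA].
- move=> a _ [x Px [y Qy <-]]; exists (a *: x); first exact: submoduleZ.
  by exists (a *: y); [exact: submoduleZ|rewrite scalerDr].
Qed.

Lemma sumsetl P Q : is_submodule Q -> P `<=` sumset P Q.
Proof.
by move=> QQ x Px; exists x => //; exists 0; [exact: submodule0|rewrite addr0].
Qed.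

Lemma sumsetr P Q : is_submodule P -> Q `<=` sumset P Q.
Proof.
by move=> PP x Qx; exists 0; [exact: submodule0|exists x; rewrite ?add0r].
Qed.

Lemma colon_submodule P (a : A) :
  is_submodule P -> is_submodule [set x | P (a *: x)].
Proof.
move=> PP; apply/is_submoduleP; split=> /= [|x y Px Py|b x Px].
- by rewrite scaler0; exact: submodule0.
- by rewrite scalerDr; exact: submoduleD.
- by rewrite scalerA mulrC -scalerA; exact: submoduleZ.
Qed.

Lemma scale_image_submodule P (a : A) :
  is_submodule P -> is_submodule [set a *: x | x in P].
Proof.
move=> PP; apply/is_submoduleP; split=> [|_ _ [x Px <-] [y Py <-]|b _ [x Px <-]].
- by exists 0; [exact: submodule0|rewrite scaler0].
- by exists (x + y); [exact: submoduleD|rewrite scalerDr].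
- by exists (b *: x); [exact: submoduleZ|rewrite !scalerA mulrC].
Qed.

Lemma conductor_ideal P : is_submodule P -> is_ideal [set a : A | forall x, P (a *: x)].
Proof.
move=> PP; apply/(@is_submoduleP A A^o); split=> /= [x|a b Pa Pb x|a b Pb x].
- by rewrite scale0r; exact: submodule0.
- by rewrite scalerDl; exact: submoduleD.
- by rewrite -[a *: b]/(a * b) -scalerA; exact: submoduleZ.
Qed.

Lemma lincomb_submodule J (s : seq M) : is_ideal J -> is_submodule
  [set x | exists g : nat -> A,
     (forall i, J (g i)) /\ x = \sum_(i < size s) g i *: s`_i].
Proof.
move=> idJ; apply/is_submoduleP; split=> [|_ _ [g [Jg ->]] [h [Jh ->]]|a _ [g [Jg ->]]].
- exists (fun=> 0); split=> [_|]; first exact: ideal0.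
  by rewrite big1 // => i _; rewrite scale0r.
- exists (fun i => g i + h i); split=> [i|]; first exact: idealD.
  by rewrite -big_split; apply: eq_bigr => i _; rewrite scalerDl.
- exists (fun i => a * g i); split=> [i|]; first exact: idealMl.
  by rewrite scaler_sumr; apply: eq_bigr => i _; rewrite scalerA.
Qed.

Lemma span_seqP (s : seq M) x : span [set` s] x ->
  exists g : nat -> A, x = \sum_(i < size s) g i *: s`_i.
Proof.
have PT := lincomb_submodule s (submoduleT A^o).
suff: span [set` s] `<=` [set x | exists g : nat -> A,
     (forall i, [set: A] (g i)) /\ x = \sum_(i < size s) g i *: s`_i].
  by move=> H /H [g [_ ->]]; exists g.
apply: span_ind => // y /= ys; exists (fun i => (i == index y s)%:R); split=> //.
have ltys : (index y s < size s)%N by rewrite index_mem.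
rewrite (bigD1 (Ordinal ltys)) //= eqxx scale1r nth_index // big1 ?addr0 // => i ne.
by rewrite -val_eqE /= in ne; rewrite (negPf ne) scale0r.
Qed.

Lemma smul_span_seqP J (s : seq M) x : is_ideal J -> smul J (span [set` s]) x ->
  exists g : nat -> A, (forall i, J (g i)) /\ x = \sum_(i < size s) g i *: s`_i.
Proof.
move=> idJ; move: x; apply: span_ind; first exact: lincomb_submodule.
move=> _ [a Ja [x /span_seqP[g ->] <-]]; exists (fun i => a * g i); split.
  by move=> i; exact: idealMr.
by rewrite scaler_sumr; apply: eq_bigr => i _; rewrite scalerA.
Qed.

End Span.

(** * Ascending chain conditions and finite generation *)

Section ChainConditions.
Variables (A : comPzRingType) (M : lmodType A).

(** The scalars form a mere set [G], so that Hilbert's basis argument can adjoin ring generators one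
    at a time without building subrings. Closure under differences is required separately because
    [G] need not contain -1. *)
Definition stable (G : set A) (J : set M) : Prop :=
  [/\ J 0, forall x y, J x -> J y -> J (x - y) &
      forall g x, G g -> J x -> J (g *: x)].

Lemma stable_submodule J : stable [set: A] J <-> is_submodule J.
Proof.
split=> [[J0 JB JZ]|JJ].
  apply/is_submoduleP; split=> // [x y Jx Jy|a x Jx]; last exact: JZ.
  by rewrite -[y]opprK; apply: (JB _ _) => //; rewrite -sub0r; exact: JB.
split; first exact: submodule0.
  by move=> x y; exact: submoduleB.
by move=> a x _; exact: submoduleZ.
Qed.

Lemma stableD G J x y : stable G J -> J x -> J y -> J (x + y).
Proof.
by case=> J0 JB _ Jx Jy; rewrite -[y]opprK; apply: (JB _ _) => //; rewrite -sub0r; exact: JB.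
Qed.

Lemma stable_sum G J (I : Type) (r : seq I) (Q : pred I) (f : I -> M) :
  stable G J -> (forall i, Q i -> J (f i)) -> J (\sum_(i <- r | Q i) f i).
Proof.
move=> GJ Jf; elim/big_ind: _ => //; first by case: GJ.
by move=> x y; exact: stableD GJ.
Qed.

Definition acc_on (G : set A) (E : set M) : Prop :=
  forall J : nat -> set M, (forall n, stable G (J n)) ->
    (forall n, J n `<=` E) -> (forall n, J n `<=` J n.+1) ->
    exists n, forall m, (n <= m)%N -> J m `<=` J n.

Definition acc : Prop := acc_on [set: A] [set: M].

Lemma accP : acc -> forall J : nat -> set M, (forall n, is_submodule (J n)) ->
    (forall n, J n `<=` J n.+1) ->
    exists n, forall m, (n <= m)%N -> J m `<=` J n.
Proof. by move=> accM J JJ; apply: accM => // n; apply/stable_submodule. Qed.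

Lemma acc_max (F : set (set M)) : acc -> (forall L, F L -> is_submodule L) ->
  F !=set0 -> exists2 L, F L & forall K, F K -> L `<=` K -> K `<=` L.
Proof.
move=> accM subF [L0 FL0]; apply: contrapT => noMax.
have next (L : {L | F L}) : exists K : {L | F L},
    sval L `<=` sval K /\ ~ (sval K `<=` sval L).
  case: L => L FL /=; apply: contrapT => noK; apply: noMax; exists L => // K FK LK.
  by apply: contrapT => nKL; apply: noK; exists (exist _ K FK).
have [f [_ f_S]] := dep_choice (exist _ L0 FL0) next.
have [n fn] := accP accM (fun n => subF _ (svalP (f n))) (fun n => (f_S n).1).
by case: (f_S n) => _; apply; exact: fn.
Qed.

(** A span that is maximal among the spans of finite subsets of [X] absorbs each element of [X]. The
    generators are thus found inside [X], which matters when [X] is a set of initial forms or the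
    image of a prime. *)
Lemma acc_fg (X : set M) : acc ->
  exists2 s : seq M, [set` s] `<=` X & span X = span [set` s].
Proof.
move=> accM.
have [||_ [s sX <-] smax] := @acc_max
  [set span [set` s] | s in [set s : seq M | [set` s] `<=` X]] accM.
- by move=> _ [s _ <-]; exact: span_submodule.
- by exists (span [set` [::]]); exists [::].
exists s => //; apply/seteqP; split; last exact: span_mono.
apply: span_ind; first exact: span_submodule.
move=> x Xx; apply: (smax (span [set` x :: s])).
- by exists (x :: s) => // y /=; rewrite inE => /predU1P[->|/sX].
- by apply: span_mono => y /=; rewrite inE orbC => ->.
- by apply: span_mem; rewrite /= inE eqxx.
Qed.

End ChainConditions.
Arguments acc {A} M.
Arguments stable_sum {A M G J I r Q f}.

Section Noetherian.
Variable A : comPzRingType.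

(* Two nested submodules that agree on [E] and modulo [E] coincide; here the
   successive quotient is cyclic, generated by [e]. *)
Lemma acc_on_adjoin (M : lmodType A) (E : set M) (e : M) : acc A^o ->
  stable [set: A] E -> acc_on [set: A] E ->
  acc_on [set: A] [set x | exists a y, E y /\ x = a *: e + y].
Proof.
move=> accA [E0 EB EZ] accE J JJ JE J_S.
pose C n : set A := [set a | exists2 y, E y & J n (a *: e + y)].
have [||| n1 Hn1] := accA C.
- move=> n; have [J0 JB JZ] := JJ n; split.
  + by exists 0 => //; rewrite scale0r addr0.
  + move=> a b [y Ey Jy] [z Ez Jz]; exists (y - z); first exact: EB.
    by rewrite scalerBl addrACA -opprD; exact: JB.
  + move=> g a _ [y Ey Jy]; exists (g *: y); first exact: EZ.
    by rewrite -[g *: a]/(g * a) -scalerA -scalerDr; exact: JZ.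
- by [].
- by move=> n a [y Ey Jy]; exists y => //; exact: J_S.
have [||| n2 Hn2] := accE (fun n => J n `&` E).
- move=> n; have [J0 JB JZ] := JJ n; split; first by split.
  + by move=> x y [Jx Ex] [Jy Ey]; split; [exact: JB|exact: EB].
  + by move=> g x Gg [Jx Ex]; split; [exact: JZ|exact: EZ].
- by move=> n x [].
- by move=> n x [Jx Ex]; split=> //; exact: J_S.
exists (maxn n1 n2) => m; rewrite geq_max => /andP[n1m n2m] x Jx.
have [a [y [Ey xE]]] := JE _ _ Jx.
have [|y' Ey' Jy'] := Hn1 m n1m a; first by exists y; rewrite -?xE.
rewrite (_ : x = (a *: e + y') + (y - y')); last first.
  by rewrite xE -addrA [y' + _]addrC subrK.
apply: (stableD (JJ _)).
  exact: (chain_le J_S (leq_maxl n1 n2)).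
apply: (chain_le J_S (leq_maxr n1 n2)).
suff [] : (J n2 `&` E) (y - y') by [].
apply: (Hn2 m n2m); split; last exact: EB.
have -> : y - y' = x - (a *: e + y') by rewrite xE opprD addrACA subrr add0r.
by have [_ JB _] := JJ m; apply: JB => //; exact: (chain_le J_S n1m).
Qed.

Lemma noetherian_acc : noetherian A -> acc A^o.
Proof.
move=> noeA J JJ _ J_S.
have [|s sE] := noeA (\bigcup_n J n).
  apply/(@is_submoduleP A A^o); split=> [|x y [m _ Jx] [n _ Jy]|a x [n _ Jx]].
  - by exists 0%N => //; have [] := JJ 0%N.
  - exists (maxn m n) => //; apply: (stableD (JJ _)).
      exact: (chain_le J_S (leq_maxl m n)).
    exact: (chain_le J_S (leq_maxr m n)).
  - by exists n => //; have [_ _] := JJ n; apply.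
have [n Hn] : exists n, [set` s] `<=` J n.
  have : [set` s] `<=` \bigcup_n J n by rewrite sE => x; exact: span_mem.
  elim: s {sE} => [_|x s IHs sJ]; first by exists 0%N.
  have [|n Jn] := IHs; first by move=> y /= ys; apply: sJ; rewrite /= inE ys orbT.
  have [|m _ Jm] := sJ x; first by rewrite /= inE eqxx.
  exists (maxn m n) => y /=; rewrite inE => /predU1P[->|/Jn].
    exact: (chain_le J_S (leq_maxl m n)).
  exact: (chain_le J_S (leq_maxr m n)).
exists n => m _ x Jx.
have : (\bigcup_n J n) x by exists m.
rewrite sE; apply: (@span_ind A A^o) Hn _.
by apply/(@stable_submodule A A^o).
Qed.

Lemma acc_finitely_generated (M : lmodType A) :
  acc A^o -> finitely_generated M -> acc M.
Proof.
move=> accA [s sT]; suff: acc_on [set: A] (span [set` s]) by rewrite sT.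
elim: s {sT} => [|e s IHs].
  move=> J JJ JE J_S; exists 0%N => m _ x /JE x0.
  have : [set 0] x; last by move=> ->; have [] := JJ 0%N.
  apply: span_ind x0 => //; apply/is_submoduleP; split=> //= [_ _ -> ->|a _ ->].
    by rewrite addr0.
  by rewrite scaler0.
move=> J JJ JE; apply: (acc_on_adjoin (E := span [set` s]) (e := e)) => //.
  by apply/stable_submodule; exact: span_submodule.
move=> n x /JE /span_seqP[g ->] /=; rewrite big_ord_recl /=.
exists (g 0%N), (\sum_(i < size s) g i.+1 *: s`_i); split=> //.
apply: submodule_sum; first exact: span_submodule.
move=> i _; apply: (submoduleZ _ (span_submodule _)); apply: span_mem.
exact: mem_nth.
Qed.

End Noetherian.

(** * Hilbert's basis theorem and the extended Rees module *)

Section HilbertBasis.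
Variables (C : comPzRingType) (M : lmodType C).
Variables (G : set C) (E : set M) (c : C).
Hypothesis GE : stable G E.

(** Values at [c] of polynomials of degree less than [n] with coefficients in [E]; one element may
    have several such expressions. *)
Definition poly_lt (n : nat) : set M := [set x | exists e : nat -> M,
  (forall i, E (e i)) /\ x = \sum_(i < n) c ^+ i *: e i].

Definition adjoin : set M := \bigcup_n poly_lt n.

Lemma poly_lt_stable n : stable G (poly_lt n).
Proof.
have [E0 EB EZ] := GE; split.
- by exists (fun=> 0); split=> //; rewrite big1 // => i _; rewrite scaler0.
- move=> _ _ [e [Ee ->]] [f [Ef ->]]; exists (fun i => e i - f i); split.
    by move=> i; exact: EB.
  by rewrite -sumrB; apply: eq_bigr => i _; rewrite scalerBr.
- move=> g _ Gg [e [Ee ->]]; exists (fun i => g *: e i); split.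
    by move=> i; exact: EZ.
  by rewrite scaler_sumr; apply: eq_bigr => i _; rewrite !scalerA mulrC.
Qed.

Lemma poly_ltS n x : poly_lt n.+1 x <->
  exists e y, [/\ E e, poly_lt n y & x = c ^+ n *: e + y].
Proof.
split=> [[e [Ee ->]]|[e [_ [Ee [f [Ef ->]] ->]]]].
  exists (e n), (\sum_(i < n) c ^+ i *: e i); split=> //; first by exists e.
  by rewrite big_ord_recr addrC.
exists (fun i => if (i == n)%N then e else f i); split=> [i|]; first by case: eqP.
rewrite big_ord_recr /= eqxx addrC; congr (_ + _); apply: eq_bigr => i _.
by rewrite ltn_eqF.
Qed.

Lemma poly_lt_chain m n : (m <= n)%N -> poly_lt m `<=` poly_lt n.
Proof.
apply: (@chain_le _ poly_lt) => {m}n x nx; apply/poly_ltS.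
by exists 0, x; have [E0 _ _] := GE; split=> //; rewrite scaler0 add0r.
Qed.

Lemma poly_lt_scale n x : poly_lt n x -> poly_lt n.+1 (c *: x).
Proof.
case=> e [Ee ->]; exists (fun i => if i is k.+1 then e k else 0); split.
  by case=> // ; have [] := GE.
rewrite big_ord_recl scaler0 add0r scaler_sumr; apply: eq_bigr => i _.
by rewrite scalerA -exprS.
Qed.

Lemma sub_adjoin : E `<=` adjoin.
Proof.
move=> x Ex; exists 1%N => //; apply/poly_ltS; exists x, 0.
by have [] := poly_lt_stable 0; split=> //; rewrite expr0 scale1r addr0.
Qed.

Lemma adjoin_stable : stable (G `|` [set c]) adjoin.
Proof.
split.
- by exists 0%N => //; have [] := poly_lt_stable 0.
- move=> x y [m _ mx] [n _ ny]; exists (maxn m n) => //.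
  have [_ PB _] := poly_lt_stable (maxn m n); apply: PB.
    by apply: poly_lt_chain mx; exact: leq_maxl.
  by apply: poly_lt_chain ny; exact: leq_maxr.
- move=> g x [Gg|->] [n _ nx].
    by exists n => //; have [_ _] := poly_lt_stable n; apply.
  by exists n.+1 => //; exact: poly_lt_scale.
Qed.

(** Coefficients of [c ^+ n] in expressions of elements of [J] of degree at most [n]: the leading
    coefficients of Hilbert's proof, zero included. *)
Definition lead (J : set M) (n : nat) : set M :=
  [set e | E e /\ exists2 y, poly_lt n y & J (c ^+ n *: e + y)].

Lemma lead_stable J n : stable G J -> stable G (lead J n).
Proof.
move=> [J0 JB JZ]; have [E0 EB EZ] := GE; have [P0 PB PZ] := poly_lt_stable n.
split.
- by split=> //; exists 0 => //; rewrite scaler0 addr0.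
- move=> e f [Ee [y ny Jy]] [Ef [z nz Jz]]; split; first exact: EB.
  exists (y - z); first exact: PB.
  by rewrite scalerBr addrACA -opprD; exact: JB.
- move=> g e Gg [Ee [y ny Jy]]; split; first exact: EZ.
  exists (g *: y); first exact: PZ.
  by rewrite scalerA mulrC -scalerA -scalerDr; exact: JZ.
Qed.

Lemma lead_mono J K n : J `<=` K -> lead J n `<=` lead K n.
Proof. by move=> JK e [Ee [y ny Jy]]; split=> //; exists y => //; exact: JK. Qed.

Lemma lead_chain J m n : stable [set c] J -> (m <= n)%N -> lead J m `<=` lead J n.
Proof.
move=> [_ _ JZ]; apply: (@chain_le _ (lead J)) => {m}n e [Ee [y ny Jy]]; split=> //.
exists (c *: y); first exact: poly_lt_scale.
by rewrite exprS -scalerA -scalerDr; exact: JZ.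
Qed.

(** Hilbert's basis theorem for chains. Once all the leading coefficients are stationary from one
    common index on, an element of a later term is reduced, degree by degree, by elements of the
    stationary term. *)
Lemma acc_on_poly : acc_on G E -> acc_on (G `|` [set c]) adjoin.
Proof.
move=> accE J JJ JE J_S.
have GJ n : stable G (J n).
  by have [J0 JB JZ] := JJ n; split=> // g x Gg; apply: JZ; left.
have cJ n : stable [set c] (J n).
  by have [J0 JB JZ] := JJ n; split=> // g x Gg; apply: JZ; right.
have [|||k0 Hk0] := accE (fun k => lead (J k) k).
- by move=> n; exact: lead_stable.
- by move=> n e [].
- move=> n; apply: (@subset_trans _ (lead (J n.+1) n)); first exact: lead_mono.
  exact: lead_chain.
have /choice[K HK] : forall n, exists k, forall m, (k <= m)%N ->
    lead (J m) n `<=` lead (J k) n.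
  move=> n; apply: (accE (fun k => lead (J k) n)).
  - by move=> k; exact: lead_stable.
  - by move=> k e [].
  - by move=> k; exact: lead_mono.
(* The diagonal chain is stationary from [k0] on and controls all degrees at least [k0]; each of the
   finitely many lower degrees contributes its own bound [K n]. *)
pose k1 := maxn k0 (\max_(n < k0) K n).
have k01 : (k0 <= k1)%N by exact: leq_maxl.
have lead_k1 n m : (k1 <= m)%N -> lead (J m) n `<=` lead (J k1) n.
  move=> k1m; have [nk0|k0n] := ltnP n k0.
    have Kn1 : (K n <= k1)%N.
      by rewrite leq_max; apply/orP; right; exact: (leq_bigmax (Ordinal nk0)).
    apply: (subset_trans (HK n m (leq_trans Kn1 k1m))).
    by apply: lead_mono; exact: chain_le.
  apply: (@subset_trans _ (lead (J (maxn m n)) (maxn m n))).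
    apply: (@subset_trans _ (lead (J (maxn m n)) n)).
      by apply: lead_mono; apply: chain_le => //; exact: leq_maxl.
    by apply: lead_chain => //; exact: leq_maxr.
  apply: (@subset_trans _ (lead (J k0) k0)).
    by apply: Hk0; rewrite leq_max k0n orbT.
  apply: (@subset_trans _ (lead (J k0) n)); first exact: lead_chain.
  by apply: lead_mono; exact: chain_le.
exists k1 => m k1m x Jx; have [n _ nx] := JE _ _ Jx.
elim: n x nx Jx => [|n IHn] x nx Jx.
  case: nx => e [_ ->]; rewrite big_ord0.
  by have [] := JJ k1.
have [e [y [Ee ny xE]]] := (poly_ltS _ _).1 nx.
have [|_ [y' ny' Jy']] := lead_k1 n m k1m e.
  by split=> //; exists y => //; rewrite -xE.
rewrite (_ : x = (c ^+ n *: e + y') + (y - y')); last first.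
  by rewrite xE -addrA [y' + _]addrC subrK.
apply: (stableD (JJ _)) => //; apply: IHn.
  by have [_ PB _] := poly_lt_stable n; exact: PB.
have -> : y - y' = x - (c ^+ n *: e + y') by rewrite xE opprD addrACA subrr add0r.
by have [_ JB _] := JJ m; apply: JB => //; exact: (chain_le J_S k1m).
Qed.

End HilbertBasis.

(** The last hypothesis expresses that [E] generates [M] under [G] and [cs]. The induction moves the
    head of [cs] into [G] and replaces [E] by [adjoin E c]. *)
Lemma acc_on_generated (C : comPzRingType) (M : lmodType C) (G : set C)
    (E : set M) (cs : seq C) : stable G E -> acc_on G E ->
  (forall F : set M, E `<=` F -> stable G F ->
     (forall c, c \in cs -> stable [set c] F) -> F = [set: M]) ->
  acc M.
Proof.
elim: cs G E => [|c cs IHcs] G E GE accE full.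
  have ET : E = [set: M] by apply: full.
  move=> J JJ _; rewrite ET in accE; apply: accE => // n.
  by have [J0 JB JZ] := JJ n; split=> // g x _; exact: JZ.
apply: (IHcs (G `|` [set c]) (adjoin E c)); first exact: adjoin_stable.
  exact: acc_on_poly.
move=> F EF [F0 FB FZ] Fcs; apply: full.
- by apply: (subset_trans _ EF); exact: sub_adjoin GE.
- by split=> // g x Gg; apply: FZ; left.
- move=> d; rewrite inE => /predU1P[->|]; last exact: Fcs.
  by split=> // g x Gg; apply: FZ; right.
Qed.

Section Rees.
Variables (R : comPzRingType) (I : set R) (M : lmodType R).

Lemma rees_monomE (i : int) (a : R^o) (Ia : powmz I R^o i a) (x : rees I M) n :
  ((monom Ia : rees_ring I) *: x) n = (a : R) *: x (n - i).
Proof.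
rewrite -[LHS]/(rees_scale (monom Ia) x n) (@rees_scaleE _ _ _ [fset i]%fset).
  by rewrite big_seq_fset1 /= eqxx.
apply/fsubsetP => m mi; rewrite inE; apply: contraTT mi => mi.
rewrite in_fset_set; last by case: (reesP (monom Ia)).
by apply/negP => /set_mem /=; rewrite (negPf mi) eqxx.
Qed.

Lemma rees_uE (x : rees I M) n : (rees_u I *: x) n = x (n + 1).
Proof. by rewrite rees_monomE scale1r opprK. Qed.

Lemma rees_cstE a (x : rees I M) n : (rees_cst I a *: x) n = a *: x n.
Proof. by rewrite rees_monomE subr0. Qed.

Lemma reesBE (x y : rees I M) n : (x - y) n = x n - y n.
Proof. by []. Qed.

Lemma rees_sumE (T : Type) (r : seq T) (P : pred T) (F : T -> rees I M) n :
  (\sum_(i <- r | P i) F i) n = \sum_(i <- r | P i) F i n.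
Proof. exact: (big_morph (fun f : rees I M => f n)). Qed.

Lemma rees_monom_sum (f : rees I M) :
  f = \sum_(n <- supp f) monom ((reesP f).2 n).
Proof.
apply: rees_eq => n; rewrite rees_sumE /=.
have [nf|nf] := boolP (n \in supp f).
  rewrite (bigD1_seq n) ?fset_uniq //= eqxx big1 ?addr0 // => i.
  by rewrite eq_sym => /negPf ->.
rewrite (suppPn nf) big1_seq // => i /andP[_ fi].
by case: eqP => // ni; rewrite ni fi in nf.
Qed.

(** The degree 0 copy of [M] generates the Rees module under the constants, [u], and the elements
    [a t] with [a] in a finite generating set of [I]. *)
Lemma acc_rees : is_ideal I -> acc R^o -> acc M -> acc (rees I M).
Proof.
move=> idI accR accM.
have [s sI Is] := @acc_fg R R^o I accR; rewrite (@span_id R R^o I idI) in Is.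
(* [T a] is the element [a t] of the Rees ring; outside [I] its value is the irrelevant default
   0. *)
have /choice[T HT] : forall a, exists c : rees_ring I, I a ->
    forall (x : rees I M) n, (c *: x) n = a *: x (n - 1).
  move=> a; have [Ia|nIa] := pselect (I a); last by exists 0.
  suff Ia1 : powmz I R^o 1 a by exists (monom Ia1) => _ x n; exact: rees_monomE.
  rewrite -[a]mulr1; apply: powm_scale_in.
  by rewrite -[a]mulr1; apply: span_mem; exists a => //; exists 1.
pose c0 x : rees I M := monom (n := 0) (M := M) (x := x)
  (eq_ind_r (fun P : set M => P x) Logic.I (powm0 I M)).
apply: (@acc_on_generated _ _ (range (rees_cst I)) (range c0) (rees_u I :: map T s)).
- split.
  + by exists 0 => //; apply: rees_eq => n /=; case: eqP.
  + move=> _ _ [x _ <-] [y _ <-]; exists (x - y) => //; apply: rees_eq => n.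
    by rewrite reesBE /=; case: eqP => // _; rewrite subr0.
  + move=> _ _ [a _ <-] [x _ <-]; exists (a *: x) => //; apply: rees_eq => n.
    by rewrite rees_cstE /=; case: eqP => // _; rewrite scaler0.
- move=> J JJ JE J_S.
  have [||k Hk] := accP accM (J := fun n => [set x | J n (c0 x)]).
  + move=> n; apply/stable_submodule; have [J0 JB JZ] := JJ n; split=> /=.
    * suff <- : 0 = c0 0 by [].
      by apply: rees_eq => m /=; case: eqP.
    * move=> x y Jx Jy; suff -> : c0 (x - y) = c0 x - c0 y by exact: JB.
      by apply: rees_eq => m; rewrite reesBE /=; case: eqP => // _; rewrite subr0.
    * move=> a x _ Jx; suff -> : c0 (a *: x) = rees_cst I a *: c0 x by apply: JZ.
      by apply: rees_eq => m; rewrite rees_cstE /=; case: eqP => // _; rewrite scaler0.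
  + by move=> n x /=; exact: J_S.
  exists k => m km x Jx; have [y _ yx] := JE _ _ Jx.
  by rewrite -yx; apply: (Hk m) => //=; rewrite yx.
move=> F EF GF cF; apply/seteqP; split=> // f _.
rewrite [f]rees_monom_sum; apply: (stable_sum GF) => n _.
have [F0 FB FZ] := GF.
(* [Q n] collects the [x] for which [x t^n] exists and lies in [F]. It suffices to reach each
   homogeneous component of [f]: upwards from degree 0 through the [T b], downwards through [u]. *)
pose Q n := [set x : M | exists2 g, F g & forall m, g m = if m == n then x else 0].
have QQ n' : is_submodule (Q n').
  apply/stable_submodule; split.
  - by exists 0 => // m; case: eqP.
  - move=> x y [g Fg gx] [h Fh hy]; exists (g - h); first exact: FB.
    by move=> m; rewrite reesBE gx hy; case: eqP => // _; rewrite subr0.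
  - move=> a x _ [g Fg gx]; exists (rees_cst I a *: g); first by apply: FZ => //; exists a.
    by move=> m; rewrite rees_cstE gx; case: eqP => // _; rewrite scaler0.
have Q0 x : Q 0 x by exists (c0 x) => //; apply: EF; exists x.
suff [g Fg gE] : Q n (f n).
  suff -> : monom ((reesP f).2 n) = g by [].
  by apply: rees_eq => m; rewrite gE.
have QS k b z : I b -> Q (Posz k) z -> Q (Posz k.+1) (b *: z).
  rewrite Is; move: b; apply: (@span_ind R R^o).
    apply/(@is_submoduleP R R^o); split=> [Qz|a b Qa Qb Qz|a b Qb Qz].
    - by rewrite scale0r; exact: submodule0.
    - by rewrite scalerDl; apply: submoduleD => //; [exact: Qa|exact: Qb].
    - by rewrite -[a *: b]/(a * b) -scalerA; apply: submoduleZ => //; exact: Qb.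
  move=> b sb [g Fg gz]; exists (T b *: g).
    have Tb : T b \in rees_u I :: map T s by rewrite inE map_f ?orbT.
    by have [_ _] := cF _ Tb; apply.
  move=> m; rewrite HT; last exact: sI.
  have -> : (m == Posz k.+1) = (m - 1 == Posz k) by lia.
  rewrite gz.
  by case: eqP => // _; rewrite scaler0.
case: (reesP f) => _ /(_ n); case: n => [k|k] /=.
  apply: span_ind => // _ [a Ia [y _ <-]].
  elim: k a Ia y => [|k IHk] a Ia y; first exact: Q0.
  move: a Ia y; apply: (@span_ind R R^o).
    apply/(@is_submoduleP R R^o); split=> [y|a b Qa Qb y|a b Qb y].
    - by rewrite scale0r; exact: submodule0.
    - by rewrite scalerDl; exact: submoduleD.
    - by rewrite -[a *: b]/(a * b) -scalerA; apply: submoduleZ => //; exact: Qb.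
  move=> _ [b Ib [a Ia <-]] y; rewrite -[b *: a]/(b * a) -scalerA.
  by apply: QS => //; exact: IHk.
move: (f (Negz k)) => y _; suff Qu i x : Q (1 + i) x -> Q i x.
  elim: k => [|k IHk]; first by apply: Qu; exact: Q0.
  by apply: Qu; rewrite [1 + _](_ : _ = Negz k) // !NegzE; lia.
case=> g Fg gx; exists (rees_u I *: g).
  by have [_ _] := cF (rees_u I) (mem_head _ _); apply.
by move=> m; rewrite rees_uE gx [m + 1]addrC (inj_eq (addrI _)).
Qed.

End Rees.

Lemma acc_rees_ring (R : comPzRingType) (I : set R) :
  is_ideal I -> acc R^o -> acc (rees_ring I)^o.
Proof. by move=> idI accR; exact: (@acc_rees R I R^o idI accR accR). Qed.

(** * Localization at a prime *)

Section Localization.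
Variables (A : comPzRingType) (S : mul_set A) (M : lmodType A).
Implicit Types (T : set M) (x y : M) (s t : denom S).

Lemma frac_scale_mk (a : A^o) s x t :
  (mk_frac a s : frac_ring S) *: (mk_frac x t : frac S M) =
  mk_frac ((a : A) *: x) (denomM s t).
Proof. exact: frac_scaleE. Qed.

Lemma to_frac_scale a x t :
  to_frac S a *: (mk_frac x t : frac S M) = mk_frac (a *: x) t.
Proof.
by rewrite frac_scale_mk; apply: mk_frac_eq; rewrite /= mul1r.
Qed.

Lemma mk_frac_scale1 x s :
  mk_frac x s = (mk_frac (1 : A^o) s : frac_ring S) *: mk_frac x (denom1 S).
Proof.
by rewrite frac_scale_mk; apply: mk_frac_eq; rewrite /= mulr1 scale1r.
Qed.

Lemma mk_frac0 s : mk_frac (0 : M) s = 0.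
Proof. by apply: mk_frac_eq; rewrite !scaler0. Qed.

Lemma mk_fracDs x y s : mk_frac x s + mk_frac y s = mk_frac (x + y) s.
Proof.
by rewrite mk_fracD; apply: mk_frac_eq; rewrite /= -scalerDr scalerA.
Qed.

Definition frac_set T : set (frac S M) := [set z | exists x s, T x /\ z = mk_frac x s].

Lemma frac_set_submodule T : is_submodule T -> is_submodule (frac_set T).
Proof.
move=> TT; apply/is_submoduleP; split.
- by exists 0, (denom1 S); split; [exact: submodule0|rewrite mk_frac0].
- move=> _ _ [x [s [Tx ->]]] [y [t [Ty ->]]].
  exists (den t *: x + den s *: y), (denomM s t); rewrite mk_fracD; split=> //.
  by apply: submoduleD => //; exact: submoduleZ.
- move=> a _ [x [s [Tx ->]]]; elim/fracW: a => a t.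
  exists (a *: x), (denomM t s); split; first exact: submoduleZ.
  exact: frac_scale_mk.
Qed.

Lemma frac_setP T x s : is_submodule T ->
  frac_set T (mk_frac x s) -> exists t : denom S, T (den t *: x).
Proof.
move=> TT [y [t [Ty /mk_fracP[r E]]]]; exists (denomM r t) => /=.
by rewrite -scalerA E; do 2 apply: submoduleZ => //.
Qed.

(** A submodule of the localization is determined by the [x] with [x / 1] in it, so chains can be
    compared after contraction to [M]. *)
Lemma acc_frac : acc M -> acc (frac S M).
Proof.
move=> accM J JJ _ J_S.
have subJ n : is_submodule (J n) by apply/stable_submodule.
have [||n Hn] := accP accM (J := fun n => [set x | J n (mk_frac x (denom1 S))]).
- move=> n; apply/is_submoduleP; split=> /= [|x y Jx Jy|a x Jx].
  + by rewrite mk_frac0; exact: submodule0.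
  + by rewrite -mk_fracDs; exact: submoduleD.
  + by rewrite -to_frac_scale; exact: submoduleZ.
- by move=> n x /=; exact: J_S.
exists n => m nm z; elim/fracW: z => x s Jxs.
rewrite mk_frac_scale1; apply: submoduleZ => //; apply: (Hn m nm) => /=.
suff -> : mk_frac x (denom1 S) = to_frac S (den s) *: mk_frac x s.
  exact: submoduleZ.
by rewrite to_frac_scale; apply: mk_frac_eq => /=; rewrite scale1r.
Qed.

End Localization.

Section LocalRing.
Variables (A : comPzRingType) (p : prime_ideal A).

Lemma prime_ideal_ideal : is_ideal p.
Proof. by case: (prime_idealP p). Qed.

Lemma acc_loc_ring : acc A^o -> acc (loc_ring p)^o.
Proof. exact: (@acc_frac A (prime_compl p) A^o). Qed.

Lemma loc_max_ideal : is_ideal (@loc_max A p).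
Proof. exact: (@span_submodule (loc_ring p) (loc_ring p)^o). Qed.

Lemma loc_maxP (a : A^o) (s : denom (prime_compl p)) :
  loc_max (mk_frac a s : loc_ring p) <-> (p : set A) a.
Proof.
split=> [|pa].
  have pp : @is_submodule A A^o p by exact: prime_ideal_ideal.
  have sub : loc_max (p := p) `<=` @frac_set A (prime_compl p) A^o p.
    apply: (@span_ind (loc_ring p) (loc_ring p)^o).
      exact: (@frac_set_submodule A (prime_compl p) A^o).
    by move=> _ [b pb <-]; exists b, (denom1 _).
  move=> /sub /(frac_setP pp)[t]; have [_ _ pM] := prime_idealP p.
  by move=> /pM[|//] pt; case: (denP t).
rewrite mk_frac_scale1.
apply: (idealMl loc_max_ideal); apply: (@span_mem _ (loc_ring p)^o).
by exists a.
Qed.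

Lemma loc_max1 : ~ loc_max (1 : loc_ring p).
Proof. by move/loc_maxP; case: (prime_idealP p). Qed.

Lemma loc_unit (z : loc_ring p) : ~ loc_max z -> exists y, y * z = 1.
Proof.
elim/fracW: z => a s nas; have pa : (prime_compl p : set A) a.
  by move=> pa; apply: nas; exact/loc_maxP.
exists (mk_frac (den s : A^o) (Denom pa)).
rewrite -[LHS]/(frac_scale _ _) frac_scaleE; apply: mk_frac_eq => /=.
by rewrite scale1r -[LHS]/(den s * a : A) -[RHS]/(a * den s * 1 : A) mulr1 mulrC.
Qed.

End LocalRing.

(** * Filtration of the completion; completions are Noetherian *)

Section CompletionFiltration.
Variables (A : comPzRingType) (J : set A).

Section Module.
Variable M : lmodType A.
Implicit Types (x : M) (xi eta : completion J M).

(** The kernel of the map from the completion to [M / J^n M], or equivalently the closure of the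
    image of [J^n M]. *)
Definition cpow n : set (completion J M) := [set xi | exists2 x : cauchy_seq J M,
  xi = cauchy_lim x & exists i0, forall i, (i0 <= i)%N -> powm J M n (x i)].

Lemma cpowP n (x : cauchy_seq J M) : cpow n (cauchy_lim x) <->
  exists i0, forall i, (i0 <= i)%N -> powm J M n (x i).
Proof.
split=> [[y xy [i0 yn]]|xn]; last by exists x.
have [i1 xyn] := (cauchy_limP x y).1 xy n; exists (maxn i0 i1) => i.
rewrite geq_max => /andP[i0i i1i]; rewrite -[x i](subrK (y i)).
by apply: (submoduleD (powm_submodule J M n)); [exact: xyn|exact: yn].
Qed.

Lemma cauchy_limB (x y : cauchy_seq J M) :
  cauchy_lim (x - y) = cauchy_lim x - cauchy_lim y.
Proof. by apply: (addIr (cauchy_lim y)); rewrite -cauchy_limD !subrK. Qed.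

Lemma cpowB n xi eta : cpow n xi -> cpow n eta -> cpow n (xi - eta).
Proof.
move=> [x -> [i xi0]] [y -> [j yj0]]; exists (x - y).
  by rewrite cauchy_limB.
exists (maxn i j) => k; rewrite geq_max => /andP[/xi0 xk /yj0 yk].
by apply: (submoduleB (powm_submodule J M n)).
Qed.

Lemma cpow_chain m n : (m <= n)%N -> cpow n `<=` cpow m.
Proof.
move=> mn _ [x -> [i xi0]]; exists x => //; exists i => j /xi0.
exact: powmS.
Qed.

Lemma cpow0 xi : cpow 0 xi.
Proof.
elim/cauchy_limW: xi => x; exists x => //; exists 0%N => i _.
by rewrite powm0.
Qed.

Lemma to_completionD x y :
  to_completion J (x + y) = to_completion J x + to_completion J y.
Proof. by rewrite -cauchy_limD; congr cauchy_lim; exact: cauchy_seq_eq. Qed.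

Lemma to_completion0 : to_completion J (0 : M) = 0.
Proof. by apply: (addrI (to_completion J 0)); rewrite -to_completionD !addr0. Qed.

Lemma cpow_sep xi : (forall n, cpow n xi) -> xi = 0.
Proof.
elim/cauchy_limW: xi => x xn; rewrite -to_completion0; apply/cauchy_limP => n.
have [i xi] := (cpowP n x).1 (xn n); exists i => j ij.
have : powm J M n (x j - 0) by rewrite subr0; exact: xi.
by [].
Qed.

Lemma to_completion_sum (T : Type) (r : seq T) (P : pred T) (f : T -> M) :
  to_completion J (\sum_(i <- r | P i) f i) =
  \sum_(i <- r | P i) to_completion J (f i).
Proof.
apply: (big_morph (to_completion J (M := M))); last exact: to_completion0.
exact: to_completionD.
Qed.

Lemma to_completionZ (a : A) x :
  to_completion J (a *: x) = to_completion_ring J a *: to_completion J x.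
Proof.
rewrite -[RHS]/(completion_scale _ _) completion_scaleE; congr cauchy_lim.
exact: cauchy_seq_eq.
Qed.

Lemma cpow_to_completion n x : cpow n (to_completion J x) <-> powm J M n x.
Proof.
split=> [/cpowP[i /(_ i)]|nx]; first exact.
by apply/cpowP; exists 0%N.
Qed.

Lemma cpow_approx m n xi : (m <= n)%N -> cpow m xi ->
  exists2 x, powm J M m x & cpow n (xi - to_completion J x).
Proof.
move=> mn [x -> [i xi0]]; have [j xj0] := cauchy_seqP x n.
exists (x (maxn i j)); first by apply: xi0; exact: leq_maxl.
have -> : cauchy_lim x - to_completion J (x (maxn i j)) =
  cauchy_lim (x - mk_cauchy (cauchy_cst J (x (maxn i j)))).
  by rewrite cauchy_limB.
apply/cpowP; exists j => k jk; apply: xj0 => //; exact: leq_maxr.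
Qed.

(** Completeness, allowing a loss of [D] levels: truncated subtraction leaves the first steps
    unconstrained. *)
Lemma cpow_lim D (x : nat -> M) :
  (forall n, powm J M (n - D) (x n.+1 - x n)) ->
  exists xi, forall n, cpow (n - D) (xi - to_completion J (x n)).
Proof.
move=> xS; have xD m n : (m <= n)%N -> powm J M (m - D) (x n - x m).
  move=> /subnKC <-; elim: (n - m)%N => [|k IHk].
    by rewrite addn0 subrr; exact: submodule0 (powm_submodule J M _).
  rewrite addnS -(subrK (x (m + k)%N) (x _)) -addrA.
  apply: (submoduleD (powm_submodule J M _)) => //.
  by apply: powmS (xS _); rewrite leq_sub2r // leq_addr.
have cx : cauchy J x.
  move=> k; exists (k + D)%N => i j ki kj.
  rewrite -(subrKA (x (k + D)%N)) -[x _ - x j]opprB.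
  rewrite -[in powm J M k](addnK D k).
  by apply: (submoduleB (powm_submodule J M _)); exact: xD.
exists (cauchy_lim (mk_cauchy cx)) => n.
have -> : cauchy_lim (mk_cauchy cx) - to_completion J (x n) =
  cauchy_lim (mk_cauchy cx - mk_cauchy (cauchy_cst J (x n))).
  by rewrite cauchy_limB.
by apply/cpowP; exists n => i; exact: xD.
Qed.

End Module.

Lemma to_completion_ringM (a b : A) :
  to_completion_ring J (a * b) = to_completion_ring J a * to_completion_ring J b.
Proof. exact: (@to_completionZ A^o). Qed.

Lemma cpow_scale (M : lmodType A) m n (a : completion_ring J) (xi : completion J M) :
  cpow (M := A^o) m a -> cpow n xi -> cpow (m + n) (a *: xi).
Proof.
move=> [b -> [i bi0]] [x -> [j xj0]].
rewrite -[_ *: _]/(completion_scale _ _) completion_scaleE.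
apply/cpowP; exists (maxn i j) => k; rewrite geq_max => /andP[/bi0 bk /xj0 xk].
exact: powm_scale.
Qed.

Lemma cpow_submodule (M : lmodType A) n : is_submodule (@cpow M n).
Proof.
apply/stable_submodule; split.
- by rewrite -to_completion0; apply/cpow_to_completion; exact: submodule0 (powm_submodule J M _).
- exact: cpowB.
- by move=> a x _; apply: (@cpow_scale _ 0 n); exact: cpow0.
Qed.

(** Successive approximation. Each correction by a combination of [s] pushes the remainder one level
    deeper and keeps it in [V]. The coefficients tend to 0, so their sums converge by completeness,
    and separatedness kills the final error. *)
Lemma approx_span (M : lmodType A) (V : set (completion J M))
    (s : seq (completion J M)) (n0 D : nat) :
  (forall n xi, (n0 <= n)%N -> V xi -> cpow n xi ->
    exists g : nat -> A,
      (forall i, (i < size s)%N -> powm J A^o (n - D) (g i)) /\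
      let eta := xi - \sum_(i < size s) to_completion_ring J (g i) *: s`_i in
      V eta /\ cpow n.+1 eta) ->
  forall xi, V xi -> cpow n0 xi -> span [set` s] xi.
Proof.
move=> step xi0 Vxi0 nxi0.
have /choice[g gP] (nx : nat * completion J M) : exists g : nat -> A,
    (n0 <= nx.1)%N -> V nx.2 -> cpow nx.1 nx.2 ->
    (forall i, (i < size s)%N -> powm J A^o (nx.1 - D) (g i)) /\
      let eta := nx.2 - \sum_(i < size s) to_completion_ring J (g i) *: s`_i in
      V eta /\ cpow nx.1.+1 eta.
  have [[n0n Vx nx2]|H] := pselect [/\ (n0 <= nx.1)%N, V nx.2 & cpow nx.1 nx.2].
    by have [g Hg] := step _ _ n0n Vx nx2; exists g.
  by exists (fun=> 0) => *; case: H.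
(* [x k] is the remainder after [k] corrections; [G k i] below is the partial sum of the
   coefficients of the [i]-th generator. *)
pose x := fix x k := if k is k'.+1 then x k' -
  \sum_(i < size s) to_completion_ring J (g ((n0 + k')%N, x k') i) *: s`_i else xi0.
have xP k : V (x k) /\ cpow (n0 + k) (x k).
  elim: k => [|k [Vx nx]]; first by rewrite addn0.
  by have [|_] := gP ((n0 + k)%N, x k) _ Vx nx; rewrite ?leq_addr //= addnS.
pose G k i := \sum_(j < k) g ((n0 + j)%N, x j) i.
have xE k : x k = xi0 - \sum_(i < size s) to_completion_ring J (G k i) *: s`_i.
  elim: k => [|k IHk].
    rewrite big1 ?subr0 // => i _; rewrite /G big_ord0.
    by rewrite [to_completion_ring J 0](@to_completion0 A^o) scale0r.
  rewrite [LHS]/= [in LHS]IHk -addrA -opprD -big_split; congr (_ - _).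
  apply: eq_bigr => i _; rewrite -IHk /= -scalerDl /G big_ord_recr /=; congr (_ *: _).
  by symmetry; exact: (@to_completionD A^o).
have /choice[c cP] (i : nat) : exists c : completion_ring J,
    (i < size s)%N -> forall n, cpow (M := A^o) (n - D) (c - to_completion_ring J (G n i)).
  have [lt|le] := ltnP i (size s); last by exists 0.
  suff [c cP] : exists c : completion_ring J, forall n,
      cpow (M := A^o) (n - D) (c - to_completion_ring J (G n i)) by exists c.
  apply: (@cpow_lim A^o) => n; rewrite /G big_ord_recr /= addrAC subrr add0r.
  have [Vx nx] := xP n.
  have [|+ _] := gP ((n0 + n)%N, x n) _ Vx nx; rewrite ?leq_addr //= => /(_ i lt).
  by apply: powmS; rewrite leq_sub2r // leq_addl.
suff -> : xi0 = \sum_(i < size s) c i *: s`_i.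
  apply: submodule_sum; first exact: span_submodule.
  move=> i _; apply: (submoduleZ _ (span_submodule _)); apply: span_mem.
  exact: mem_nth.
apply/eqP; rewrite -subr_eq0; apply/eqP; apply: cpow_sep => n.
(* Stage [n + D] makes up for the loss of [D] levels: there the partial sums are within level [n] of
   their limits. *)
apply: (@cpow_chain _ n (n + D - D)); first by rewrite addnK.
have -> : xi0 - \sum_(i < size s) c i *: s`_i = x (n + D)%N -
    \sum_(i < size s) (c i - to_completion_ring J (G (n + D)%N i)) *: s`_i.
  rewrite xE -addrA -opprD -big_split /=; congr (_ - _).
  by apply: eq_bigr => i _; rewrite -scalerDl addrC subrK.
apply: cpowB.
  by apply: cpow_chain (xP _).2; rewrite addnK addnCA leq_addr.
apply: submodule_sum; first exact: cpow_submodule.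
move=> i _; rewrite -[X in cpow X]addn0; apply: cpow_scale; last exact: cpow0.
exact: cP.
Qed.

Section Noetherian.
Hypotheses (idJ : is_ideal J) (accA : acc A^o).

Lemma powm_addE (M : lmodType A) m n :
  powm J M (m + n) `<=` smul (ideal_pow J m) (powm J M n).
Proof.
have SS := smul_submodule (ideal_pow J m) (powm J M n).
apply: span_ind => // _ [a Ja [y _ <-]].
elim: m a Ja {SS} y => [|m IHm] a Ja y.
  rewrite -[a *: y]scale1r; apply: span_mem; exists 1 => //; exists (a *: y) => //.
  exact: powm_scale_in.
have SS := smul_submodule (ideal_pow J m.+1) (powm J M n).
suff H : @smul A A^o J (ideal_pow J (m + n)) `<=`
    [set a | forall y, smul (ideal_pow J m.+1) (powm J M n) (a *: y)] by exact: H.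
clear a Ja y; apply: (@span_ind A A^o).
  apply/(@is_submoduleP A A^o); split=> [y|a b Sa Sb y|a b Sb y].
  - by rewrite scale0r; exact: submodule0 SS.
  - by rewrite scalerDl; apply: (submoduleD SS); [exact: Sa|exact: Sb].
  - by rewrite -[a *: b]/(a * b) -scalerA; apply: (submoduleZ _ SS); exact: Sb.
move=> _ [a Ja [b Jb <-]] y; rewrite -[a *: b]/(a * b) -scalerA.
move: (b *: y) (IHm _ Jb y) => z.
apply: (@span_ind _ _ _ [set z | smul (ideal_pow J m.+1) (powm J M n) (a *: z)]).
  exact: colon_submodule.
move=> _ [c Jc [w nw <-]] /=; rewrite scalerA; apply: span_mem.
exists (a * c); last by exists w.
by apply: (@span_mem A A^o); exists a => //; exists c.
Qed.

(** Successive approximation with no side condition: an element of [J^m M] with [m] at least [n] is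
    a combination of [s] with coefficients in [J^(m-n)], whence the loss [D = n]. *)
Lemma cpow_span (M : lmodType A) n (s : seq M) :
  powm J M n `<=` span [set` s] ->
  @cpow M n `<=` span [set` map (@to_completion _ J M) s].
Proof.
move=> ns xi nxi.
apply: (@approx_span M setT (map (@to_completion _ J M) s) n n) nxi => // m eta nm _ meta.
have [x mx xeta] := cpow_approx (leqnSn m) meta.
have [||g [Jg xE]] := @smul_span_seqP A M (ideal_pow J (m - n)) s x.
- exact: ideal_pow_ideal.
- rewrite -(subnK nm) in mx; have := powm_addE mx.
  by apply: span_mono => _ [a Ja [y ny <-]]; exists a => //; exists y => //; exact: ns.
exists g; split=> [i _|/=].
  by rewrite -[g i]mulr1; exact: powm_scale_in.
split=> //; suff -> : \sum_(i < size (map (@to_completion _ J M) s)) to_completion_ring J (g i) *: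
  (map (@to_completion _ J M) s)`_i = to_completion J x by [].
rewrite xE to_completion_sum size_map; apply: eq_bigr => i _.
by rewrite (nth_map 0) // to_completionZ.
Qed.

Lemma completion_finitely_generated (M : lmodType A) :
  acc M -> finitely_generated (completion J M).
Proof.
move=> accM; have [s _ sT] := acc_fg (powm J M 0) accM.
exists (map (@to_completion _ J M) s); apply/seteqP; split=> // xi _.
apply: (@cpow_span _ 0); last exact: cpow0.
by rewrite -sT => x; exact: span_mem.
Qed.

(** [X] consists of the initial forms of elements of the ideal, written as monomials [b t^n] in the
    Rees ring of [A]. That ring is Noetherian, so finitely many forms generate the others, and
    successive approximation shows that elements of the ideal with these forms generate the
    ideal. *)
Lemma noetherian_completion : noetherian (completion_ring J).
Proof.
move=> a ida.
pose X : set (rees_ring J)^o := [set f | exists n b (Jb : powmz J A^o (Posz n) b),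
  f = monom Jb /\ exists2 al, a al &
    cpow (M := A^o) n.+1 (al - to_completion_ring J b)].
have [s sX Xs] := acc_fg X (acc_rees_ring idJ accA).
have /choice[t tP] (f : (rees_ring J)^o) : exists t : nat * A * completion_ring J, X f ->
    [/\ exists Jb : powmz J A^o (Posz t.1.1) t.1.2, f = monom Jb, a t.2 &
      cpow (M := A^o) t.1.1.+1 (t.2 - to_completion_ring J t.1.2)].
  have [[n [b [Jb [-> [al aal nal]]]]]|nX] := pselect (X f).
    by exists (n, b, al) => _; split=> //; exists Jb.
  by exists (0%N, 0, 0).
pose d i := (t s`_i).1.1.
pose D := (\max_(i < size s) d i)%N.
exists (map (fun f => (t f).2) s); apply/seteqP; split; last first.
  apply: (@span_ind _ (completion_ring J)^o) => // _ /mapP[f fs ->].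
  by have [] := tP f (sX _ fs).
move=> xi axi; apply: (@approx_span A^o a _ 0%N D) axi _; last exact: cpow0.
move=> n eta _ aeta neta; have [b nb beta] := cpow_approx (leqnSn n) neta.
have : X (monom (nb : powmz J A^o (Posz n) b)).
  by exists n, b, nb; split=> //; exists eta.
move=> /(@span_mem _ (rees_ring J)^o); rewrite Xs => /span_seqP[h hE].
(* Only this homogeneous component of the coefficient [h i] contributes to degree [n], as the [i]-th
   generator has degree [d i]. If [d i] exceeds [n], the component has negative degree and is an
   arbitrary ring element. *)
pose g i := h i (Posz n - Posz (d i)).
have Jg i : powm J A^o (n - d i) (g i).
  rewrite /g; have [le|lt] := leqP (d i) n.
    by rewrite subzn //; exact: ((@reesP A J A^o (h i)).2 (Posz _)).
  by rewrite (eqP (ltnW lt)) powm0.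
have bE : b = \sum_(i < size s) g i * (t s`_i).1.2.
  have /(congr1 (fun f : rees J A^o => f (Posz n))) := hE.
  rewrite /= eqxx => ->; rewrite rees_sumE; apply: eq_bigr => i _.
  have [|[Jb sE] _ _] := tP s`_i; first by apply: sX; exact: mem_nth.
  rewrite {1}sE -[h i *: _]/(h i * _ : rees_ring J) mulrC.
  by rewrite -[LHS]/((_ *: (h i : rees J A^o)) _) rees_monomE mulrC.
exists g; rewrite size_map; split=> [i lt|/=].
  by apply: powmS (Jg i); rewrite leq_sub2l // (leq_bigmax (Ordinal lt)).
split.
  apply: (idealB ida) => //; apply: (@submodule_sum _ (completion_ring J)^o) => // i _.
  apply: (idealMl ida); rewrite (nth_map 0) //.
  by have [|_ ? _] := tP s`_i; first by apply: sX; exact: mem_nth.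
rewrite (_ : eta - _ = (eta - to_completion_ring J b) -
  \sum_(i < size s) to_completion_ring J (g i) *
     ((t s`_i).2 - to_completion_ring J (t s`_i).1.2)); last first.
  rewrite -addrA -opprD; congr (_ - _).
  rewrite bE [to_completion_ring J _](@to_completion_sum A^o) -big_split /=.
  apply: eq_bigr => i _; rewrite (nth_map 0) // [to_completion J _]to_completion_ringM.
  rewrite -[RHS](mulrDr (to_completion_ring J (g i))) [_ + (_ - _)]addrC.
  by rewrite -[RHS]/(_ * (_ - _ + _)) subrK.
apply: cpowB => //; apply: submodule_sum; first exact: cpow_submodule.
move=> i _.
have [|_ _ ti] := tP s`_i; first by apply: sX; exact: mem_nth.
apply: (@cpow_chain _ _ (n - d i + (d i).+1)); first by lia.
by apply: (@cpow_scale A^o) ti; apply/cpow_to_completion; exact: Jg.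
Qed.
End Noetherian.

End CompletionFiltration.

(** * Annihilator primes, Krull intersection, primary decomposition *)

Section Primes.
Variable A : comPzRingType.

Lemma annihilator_ideal (M : lmodType A) (x : M) : is_ideal (annihilator x).
Proof.
apply/(@is_submoduleP A A^o); rewrite /annihilator; split=> /= [|a b ax bx|a b bx].
- by rewrite scale0r.
- by rewrite scalerDl ax bx addr0.
- by rewrite -[a *: b]/(a * b) -scalerA bx scaler0.
Qed.

(** An annihilator that is maximal among those of the nonzero multiples of [x] is prime. *)
Lemma exists_prime_annihilator (M : lmodType A) (x : M) : acc A^o -> x != 0 ->
  exists2 a : A, a *: x != 0 & is_prime (annihilator (a *: x)).
Proof.
move=> accA x0.
have [||_ [a ax0 <-] amax] := @acc_max A A^o
  [set annihilator (a *: x) | a in [set a | a *: x != 0]] accA.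
- by move=> _ [a _ <-]; exact: annihilator_ideal.
- by exists (annihilator (1 *: x)), 1 => //=; rewrite scale1r.
exists a => //; split; first exact: annihilator_ideal.
  by rewrite /annihilator /= scale1r; exact/eqP.
move=> b c; have [|cax] := eqVneq ((c * a) *: x) 0.
  by rewrite -scalerA; right.
move=> bca; left; apply: (amax (annihilator ((c * a) *: x))).
- by exists (c * a).
- by move=> d; rewrite /annihilator /= => da; rewrite scalerA mulrCA -scalerA -(scalerA d) da scaler0.
- by rewrite /annihilator /= scalerA mulrA -scalerA.
Qed.

(** An ideal maximal among those that contain [J] and no power of [e] is prime: if neither [a] nor
    [b] lies in it, powers of [e] are multiples of [a] and of [b] modulo [w], so [a * b] in [w]
    would put a power of [e] in [w]. *)
Lemma exists_prime_avoiding (J : set A) (e : A) : acc A^o -> is_ideal J ->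
  (forall n, ~ J (e ^+ n)) -> exists w, [/\ is_prime w, J `<=` w & ~ w e].
Proof.
move=> accA idJ Je.
have [||w [idw Jw we] wmax] := @acc_max A A^o
  [set K | [/\ is_ideal K, J `<=` K & forall n, ~ K (e ^+ n)]] accA.
- by move=> K [].
- by exists J; split.
exists w; split=> //; last by move: (we 1%N); rewrite expr1.
split=> //; first by move: (we 0%N); rewrite expr0.
have grow a : ~ w a -> exists n b, w (e ^+ n - b * a).
  move=> wa; apply: contrapT => nw; apply: wa.
  pose K := @sumset A A^o w [set a *: (b : A^o) | b in setT].
  have idK : is_ideal K.
    apply: sumset_submodule => //; apply: scale_image_submodule.
    exact: submoduleT.
  apply: (wmax K).
  - split=> // [b /Jw wb|n [b wb [_ [c _ <-] bc]]].
      exact: (@sumsetl A A^o w _ (scale_image_submodule a (submoduleT A^o))).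
    apply: nw; exists n, c; rewrite -bc mulrC -[a *: c]/(a * c).
    by rewrite (addrK (a * c : A)).
  - exact: (@sumsetl A A^o w _ (scale_image_submodule a (submoduleT A^o))).
  - apply: (@sumsetr A A^o w) => //; exists 1 => //.
    exact: mulr1.
move=> a b wab; apply: contrapT => /not_orP[/grow[m [c wc]] /grow[n [d wd]]].
apply: (we (m + n)%N).
have -> : e ^+ (m + n) = e ^+ n * (e ^+ m - c * a) +
    (c * a * (e ^+ n - d * b) + c * d * (a * b)) by rewrite exprD; ring.
by apply: idealD => //; [|apply: idealD => //]; exact: idealMl.
Qed.

(** The colon ideals [(K : J^i)] become stationary at some [N]. If 1 were not in [(K : J^N)], some
    [y] outside it would be carried into it by every generator of [J]; then [y] lies in
    [(K : J^(N+1))], contradicting stationarity. *)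
Lemma ideal_pow_sub (X K : set A) : acc A^o -> is_ideal K ->
  (forall a, X a -> exists n, K (a ^+ n)) ->
  exists n, ideal_pow (@span A A^o X) n `<=` K.
Proof.
move=> accA idK XK; have [s sX ->] := @acc_fg A A^o X accA.
pose J := @span A A^o [set` s].
pose Q i := [set y : A | forall a, ideal_pow J i a -> K (a * y)].
have idQ i : is_ideal (Q i).
  apply/(@is_submoduleP A A^o); split=> [a _|x y Qx Qy a Ja|b x Qx a Ja].
  - by rewrite mulr0; exact: ideal0.
  - by rewrite mulrDr; apply: idealD => //; [exact: Qx|exact: Qy].
  - by rewrite -[b *: x]/(b * x) mulrCA; apply: idealMl => //; exact: Qx.
have [|N QN] := @accP A A^o accA Q idQ.
  by move=> i y Qy a /(ideal_powS (leqnSn i)); exact: Qy.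
have [Q1|Q1] := pselect (Q N 1).
  by exists N => a /Q1; rewrite mulr1.
suff /(_ s) [|y nQy sy] : forall t : seq A, (forall a, a \in t -> exists n, K (a ^+ n)) ->
    exists2 y, ~ Q N y & forall a, a \in t -> Q N (a * y).
- by move=> a /sX; exact: XK.
  exfalso; apply: nQy; apply: (QN N.+1) => //; apply: (@span_ind A A^o).
    apply/(@is_submoduleP A A^o); split=> [|a b Ka Kb|a b Kb].
    - by rewrite mul0r; exact: ideal0.
    - by rewrite mulrDl; exact: idealD.
    - by rewrite -[a *: b]/(a * b) -mulrA; exact: idealMl.
  move=> _ [a Ja [b Jb <-]]; rewrite -[a *: b]/(a * b) mulrAC mulrC.
  suff : Q N (a * y) by apply.
  move: a Ja; apply: (@span_ind A A^o) => //.
  apply/(@is_submoduleP A A^o); split=> [|a c Ka Kc|a c Kc].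
  - by rewrite mul0r; exact: ideal0 (idQ N).
  - by rewrite mulrDl; exact: idealD (idQ N) _ _ Ka Kc.
  - by rewrite -[a *: c]/(a * c) -mulrA; exact: idealMl (idQ N) _ _ Kc.
have KQ a : K a -> Q N a by move=> Ka b _; exact: idealMl.
clearbody Q; clear sX J QN.
 elim=> [|a {}s IHs] sX; first by exists 1.
have [|y nQy sy] := IHs; first by move=> b bs; apply: sX; rewrite inE bs orbT.
(* With [n] least such that [a ^+ n * y] is in [Q N], the element [a ^+ n.-1 * y] is still outside,
   and now [a] carries it into [Q N] too. *)
have exn : exists n, `[< Q N (a ^+ n * y) >].
  have [|n an] := sX a; first by rewrite inE eqxx.
  by exists n; apply/asboolP; apply: (idealMr (idQ N)); exact: KQ.
case: (ex_minnP exn) => n /asboolP Qn nmin.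
have n0 : n != 0%N by apply: contra_notN nQy => /eqP n0; rewrite n0 mul1r in Qn.
exists (a ^+ n.-1 * y) => [Qn1|b].
  by have := nmin n.-1 (asboolT Qn1); rewrite -ltnS prednK ?lt0n // ltnn.
rewrite inE => /predU1P[->|/sy Qby]; first by rewrite mulrA -exprS prednK ?lt0n.
by rewrite mulrCA; exact: (idealMl (idQ N)).
Qed.

End Primes.

Section PrimaryDecomposition.
Variables (A : comPzRingType) (M : lmodType A).

(** Take [L] maximal among the submodules that contain [T] and [J x] and meet [A x + T] inside
    [J x + T]. This takes the place of the Artin-Rees lemma in Krull's intersection theorem, both
    for closedness in the completion and for localization at a prime. *)
Lemma krull_submodule (T : set M) (x : M) (J : set A) : acc M -> is_submodule T ->
  is_ideal J -> exists2 L, is_submodule L & [/\ T `<=` L,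
    forall a, J a -> exists n, forall y, L (a ^+ n *: y) &
    forall b t, T t -> L (b *: x + t) ->
      exists a s, [/\ J a, T s & b *: x + t = a *: x + s]].
Proof.
move=> accM TT idJ.
pose good L := forall b t, T t -> L (b *: x + t) ->
  exists a s, [/\ J a, T s & b *: x + t = a *: x + s].
have [||L [LL TL JL Lx] Lmax] := @acc_max A M
    [set L | [/\ is_submodule L, T `<=` L, forall a, J a -> L (a *: x) & good L]] accM.
- by move=> L [].
- exists (sumset [set a *: x | a in J] T).
  have JJ : is_submodule [set a *: x | a in J].
    apply/is_submoduleP; split=> [|_ _ [a Ja <-] [b Jb <-]|b _ [a Ja <-]].
    + by exists 0; [exact: ideal0|rewrite scale0r].
    + by exists (a + b); [exact: idealD|rewrite scalerDl].
    + by exists (b * a); [exact: idealMl|rewrite scalerA].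
  split; first exact: sumset_submodule.
  + exact: sumsetr.
  + by move=> a Ja; apply: sumsetl => //; exists a.
  + by move=> b t Tt [_ [a Ja <-] [s Ts <-]]; exists a, s.
exists L => //; split=> // a Ja.
have [||n Ln] := accP accM (J := fun n => [set y | L (a ^+ n *: y)]).
- by move=> n; exact: colon_submodule.
- by move=> n y /= Ly; rewrite exprS -scalerA; exact: submoduleZ.
have aL := scale_image_submodule (a ^+ n) (@submoduleT A M).
(* [L + a^n M] still meets the condition. If [b x + t = l + a^n f], multiplying by [a] puts the left
   side in [L] because [a b] is in [J]; so [a^(n+1) f], and by the choice of [n] also [a^n f], lies
   in [L]. *)
exists n => y; apply: (Lmax (sumset L [set a ^+ n *: y | y in [set: M]])).
- split; first exact: sumset_submodule.
  + by move=> t /TL; exact: sumsetl.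
  + by move=> b /JL; exact: sumsetl.
  + move=> b t Tt [l Ll [_ [f _ <-] E]]; apply: Lx => //.
    rewrite -E; apply: submoduleD => //; apply: (Ln n.+1) => //=.
    rewrite exprS -scalerA -(addrK l (a ^+ n *: f)) [_ + l]addrC E scalerBr scalerDr.
    apply: submoduleB => //; last exact: submoduleZ.
    apply: submoduleD => //; last by apply: submoduleZ => //; exact: TL.
    by rewrite scalerA; apply: JL; exact: idealMr.
- exact: sumsetl.
- by apply: sumsetr => //; exists y.
Qed.

Definition primary_component (U L : set M) (p : set A) : Prop :=
  [/\ is_submodule L /\ U `<=` L, is_prime p,
      forall c x, ~ p c -> L (c *: x) -> L x &
      forall a, p a -> exists n, forall x, L (a ^+ n *: x)].

(** Noetherian induction: a maximal submodule without a decomposition is not an intersection of two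
    strictly larger ones, and such an irreducible submodule is itself primary, a contradiction. *)
Lemma primary_decomposition (U : set M) : acc M -> is_submodule U ->
  exists n (L : nat -> set M) (p : nat -> set A),
    (forall i, (i < n)%N -> primary_component U (L i) (p i)) /\
    forall x, (forall i, (i < n)%N -> L i x) -> U x.
Proof.
move=> accM UU; apply: contrapT => nU.
pose decomposable U := exists n (L : nat -> set M) (p : nat -> set A),
    (forall i, (i < n)%N -> primary_component U (L i) (p i)) /\
    forall x, (forall i, (i < n)%N -> L i x) -> U x.
have [||{nU UU}U [UU nU] Umax] := @acc_max A M
  [set U | is_submodule U /\ ~ decomposable U] accM.
- by move=> L [].
- by exists U.
have larger V : is_submodule V -> U `<=` V -> ~ (V `<=` U) -> decomposable V.
  by move=> VV UV VU; apply: contrapT => nV; apply: VU; exact: Umax.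
have meet V W : is_submodule V -> is_submodule W -> U `<=` V -> U `<=` W ->
    V `&` W `<=` U -> V `<=` U \/ W `<=` U.
  move=> VV WW UV UW VWU; apply: contrapT => /not_orP[VU WU]; apply: nU.
  have [n [L [p [Lp LV]]]] := larger V VV UV VU.
  have [m [K [q [Kq KW]]]] := larger W WW UW WU.
  exists (n + m)%N, (fun i => if (i < n)%N then L i else K (i - n)%N),
    (fun i => if (i < n)%N then p i else q (i - n)%N); split=> [i|x LKx].
    case: (ltnP i n) => [lin|lni] linm.
      by have [[? VL] ? ? ?] := Lp i lin; split=> //; split=> // x /UV /VL.
    have linm' : (i - n < m)%N by rewrite ltn_subLR.
    by have [[? WK] ? ? ?] := Kq _ linm'; split=> //; split=> // x /UW /WK.
  apply: VWU; split.
    by apply: LV => i lin; have := LKx i (ltn_addr m lin); rewrite lin.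
  apply: KW => i lim; have := LKx (n + i)%N; rewrite ltn_add2l => /(_ lim).
  by rewrite ltnNge leq_addr /= addKn.
pose p : set A := [set a | exists n, forall x, U (a ^+ n *: x)].
have Up a x : ~ p a -> U (a *: x) -> U x.
  move=> npa.
  have [||n Un] := accP accM (J := fun n => [set x | U (a ^+ n *: x)]).
  - by move=> n; exact: colon_submodule.
  - by move=> n y /= Uy; rewrite exprS -scalerA; exact: submoduleZ.
  have aU := scale_image_submodule (a ^+ n) (@submoduleT A M).
  (* When the colons of [U] by powers of [a] are stationary from [n] on, [U] is the intersection of
     [(U : a^(n+1))] and [U + a^n M]. One of them is therefore [U]: the first gives the claim, the
     second puts [a] in [p]. *)
  have [||||l|VU|WU] := meet [set x | U (a ^+ n.+1 *: x)]
    (sumset U [set a ^+ n *: x | x in [set: M]]).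
  - exact: colon_submodule.
  - exact: sumset_submodule.
  - by move=> y Uy /=; exact: submoduleZ.
  - exact: sumsetl.
  - move=> [/= + [y Uy [_ [z _ <-] lE]]]; rewrite -lE scalerDr => Ul.
    apply: submoduleD => //; apply: (Un (n + n.+1)%N); first exact: leq_addr.
    rewrite /= addnC exprD -scalerA -[X in U X](addKr (a ^+ n.+1 *: y)).
    apply: submoduleD => //; apply: submoduleN => //; exact: submoduleZ.
  - move=> Uax; apply: VU => /=; rewrite exprSr -scalerA; exact: submoduleZ.
  - by case: npa; exists n => y; apply: WU; apply: sumsetr => //; exists y.
suff : decomposable U by []; exists 1%N, (fun=> U), (fun=> p); split=> [_ _|x]; last exact: (fun h => h 0%N isT).
split=> //; first by split.
split.
- apply/(@is_submoduleP A A^o); split=> [|a b [m Ua] [n Ub]|b a [n Ua]].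
  + by exists 1%N => x; rewrite expr1 scale0r; exact: submodule0.
  + exists (m + n)%N => x.
    rewrite exprDn scaler_suml; apply: submodule_sum => // i _.
    have [le|lt] := leqP i n.
      by rewrite -addnBA // exprD -mulrA -mulrnAr -scalerA; exact: Ua.
    have -> : b ^+ i = b ^+ n * b ^+ (i - n) by rewrite -exprD subnKC // ltnW.
    by rewrite mulrCA -mulrnAr -scalerA; exact: Ub.
  + by exists n => x; rewrite -[b *: a]/(b * a) exprMn -scalerA; exact: submoduleZ.
(* If 1 were in [p], then [U] would be all of [M], which is the empty intersection. *)
- move=> [n]; rewrite expr1n => U1; apply: nU; exists 0%N, (fun=> U), (fun=> p).
  by split=> // x _; rewrite -[x]scale1r.
- move=> a b [n Uab]; apply: contrapT => /not_orP[npa npb].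
  have pX c m x : ~ p c -> U (c ^+ m *: x) -> U x.
    move=> npc; elim: m => [|m IHm]; first by rewrite expr0 scale1r.
    by rewrite exprS -scalerA => /(Up _ _ npc).
  suff : p a by []; exists 0%N => x; rewrite expr0 scale1r.
  by apply: (pX b n) => //; apply: (pX a n) => //; rewrite scalerA -exprMn.
Qed.

End PrimaryDecomposition.

(** * Closed submodules of a completion and Chevalley's lemma *)

Section CompletionSubmodules.
Variables (B : comPzRingType) (m : set B).
Hypotheses (idm : is_ideal m) (accB : acc B^o).

Lemma acc_completion_ring : acc (completion_ring m)^o.
Proof. by apply: noetherian_acc; exact: noetherian_completion. Qed.

Lemma acc_completion (F : lmodType B) : acc F -> acc (completion m F).
Proof.
move=> accF; apply: acc_finitely_generated; first exact: acc_completion_ring.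
exact: completion_finitely_generated.
Qed.

Lemma powm1 (b : B) : powm m B^o 1 b <-> m b.
Proof.
split=> [/powm_regular|mb].
  by apply: (@span_ind B B^o) => // _ [a ma [x _ <-]]; exact: idealMr.
apply: (@span_mem B B^o); exists b; last by exists 1 => //; exact: mulr1.
by apply: (@span_mem B B^o); exists b => //; exists 1 => //; exact: mulr1.
Qed.

Lemma cpow1_ideal : is_ideal (@cpow B m B^o 1 : set (completion_ring m)).
Proof. exact: (@cpow_submodule B m B^o 1). Qed.

(* The geometric series, in the form of a successive approximation of 1. *)
Lemma cpow1_unit (a : completion_ring m) : cpow (M := B^o) 1 a ->
  exists c, c * (1 - a) = 1.
Proof.
move=> a1.
have [|g E] := @span_seqP _ (completion_ring m)^o [:: 1 - a] 1; last first.
  by exists (g 0%N); rewrite big_ord1 /= in E.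
apply: (@approx_span B m B^o setT [:: 1 - a] 0 0) => //; last exact: cpow0.
move=> n xi _ _ nxi; have [x nx xxi] := cpow_approx (leqnSn n) nxi.
exists (fun=> x); split=> [i _|/=]; first by rewrite subn0.
split=> //; rewrite big_ord1 /=.
rewrite (_ : _ - _ = (xi - to_completion m x) + to_completion_ring m x * a).
  apply: submoduleD => //; first exact: cpow_submodule.
  rewrite -[X in cpow X]addn1; apply: (@cpow_scale B m B^o) => //.
  exact/cpow_to_completion.
rewrite -[_ *: _]/(to_completion_ring m x * (1 - a)) mulrBr mulr1.
by rewrite opprB addrA addrAC.
Qed.

(** Apply [krull_submodule] to [psi], [V] and the ideal [cpow 1]. The resulting [L] contains some
    [cpow r], hence [psi], because [psi] is approximated by [V] at level [r]. So [psi = a psi + w]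
    with [w] in [V] and [a] in [cpow 1], and [1 - a] is a unit. *)
Lemma completion_closed (F : lmodType B) (V : set (completion m F)) psi :
  acc F -> is_submodule V ->
  (forall r, exists2 v, V v & cpow r (psi - v)) -> V psi.
Proof.
move=> accF VV Vpsi.
have [L LL [VL Lm Lpsi]] := @krull_submodule _ _ V psi _ (acc_completion accF) VV cpow1_ideal.
pose K := [set b | forall xi, L (to_completion_ring m b *: xi)].
have idK : is_ideal K.
  apply/(@is_submoduleP B B^o); split=> [xi|a b Ka Kb xi|a b Kb xi].
  - by rewrite [to_completion_ring m 0](@to_completion0 B m B^o) scale0r; exact: submodule0.
  - by rewrite [to_completion_ring m _](@to_completionD B m B^o) scalerDl; exact: submoduleD.
  - by rewrite -[a *: b]/(a * b) to_completion_ringM -scalerA; exact: submoduleZ.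
have [|r Kr] := @ideal_pow_sub B m K accB idK.
  move=> b mb; have [|n Ln] := Lm (to_completion_ring m b).
    by apply/cpow_to_completion; exact/powm1.
  exists n => xi; suff -> : to_completion_ring m (b ^+ n) = to_completion_ring m b ^+ n.
    exact: Ln.
  by elim: n {Ln} => // n IHn; rewrite !exprS to_completion_ringM IHn.
rewrite (@span_id B B^o) // in Kr.
have cpowL : cpow r `<=` L.
  have [s sr rs] := acc_fg (powm m F r) accF.
  have rL : powm m F r `<=` [set e | L (to_completion m e)].
    apply: span_ind.
      apply/is_submoduleP; split=> /= [|x y Lx Ly|b x Lx].
      - by rewrite to_completion0; exact: submodule0.
      - by rewrite to_completionD; exact: submoduleD.
      - by rewrite to_completionZ; exact: submoduleZ.
    by move=> _ [b /Kr Kb [x _ <-]] /=; rewrite to_completionZ; exact: Kb.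
  apply: (@subset_trans _ (span [set` map (@to_completion _ m F) s])).
    apply: cpow_span => // x rx; rewrite -rs; exact: span_mem.
  by apply: span_ind => // _ /mapP[e es ->]; apply: rL; exact: sr.
have [v Vv rv] := Vpsi r.
have [||a [w [a1 Vw E]]] := Lpsi 1 0.
- exact: submodule0.
- rewrite scale1r addr0 -(subrK v psi); apply: submoduleD => //.
    exact: cpowL.
  exact: VL.
have [c cE] := cpow1_unit a1.
rewrite -[psi]scale1r -cE -scalerA; apply: submoduleZ => //.
by rewrite scalerBl scale1r; rewrite scale1r addr0 in E; rewrite {1}E addrAC subrr add0r.
Qed.

Section LocalUnits.
Hypothesis unitm : forall b, ~ m b -> exists c, c * b = 1.

Lemma completion_unit (a : completion_ring m) :
  ~ cpow (M := B^o) 1 a -> exists c, c * a = 1.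
Proof.
move=> na1; have [x _ xa] := cpow_approx (leq0n 1) (cpow0 a).
have [|y yx] := unitm (b := x).
  move=> mx; apply: na1; rewrite -[a](subrK (to_completion_ring m x)).
  by apply: (idealD cpow1_ideal) => //; apply/cpow_to_completion; exact/powm1.
have [|c cE] := @cpow1_unit (- (to_completion_ring m y * (a - to_completion_ring m x))).
  rewrite -mulrN; apply: (idealMl cpow1_ideal).
  by rewrite -mulN1r; apply: (idealMl cpow1_ideal).
exists (c * to_completion_ring m y); rewrite -mulrA -cE; congr (_ * _).
by rewrite opprK mulrBr -to_completion_ringM yx addrCA subrr addr0.
Qed.

Variable F : lmodType B.
Hypothesis accF : acc F.
Variable T : nat -> set F.
Hypotheses (TT : forall k, is_submodule (T k))
  (T_S : forall k, T k.+1 `<=` T k).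

Lemma T_chain j k : (j <= k)%N -> T k `<=` T j.
Proof.
move=> /subnK <-; elim: (k - j)%N => // i IHi x /T_S; exact: IHi.
Qed.

(** A Mittag-Leffler condition: modulo [P], what [T k0] has in [Q] survives in every later [T k]. It
    stands for the descending chain condition on [Q / P], restricted to the chain [T]. *)
Definition stabilizes (Q P : set F) : Prop := exists k0, forall k, (k0 <= k)%N ->
  forall t, T k0 t -> Q t -> sumset (T k) P t.

Lemma stabilizes_trans Q P P' : is_submodule Q -> is_submodule P -> P `<=` Q -> 
  stabilizes Q P -> stabilizes P P' -> stabilizes Q P'.
Proof.
move=> QQ PP PQ [k0 H0] [k1 H1]; exists (maxn k0 k1) => k.
rewrite geq_max => /andP[k0k k1k] t Tt Qt.
have [t' Tt' [q Pq tE]] := H0 k k0k t (T_chain (leq_maxl k0 k1) Tt) Qt.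
have [|t2 Tt2 [q2 Pq2 qE]] := H1 k k1k q _ Pq.
  rewrite (_ : q = t - t'); last by rewrite -tE addrC addKr.
  by apply: submoduleB => //; [apply: T_chain Tt; exact: leq_maxr|exact: T_chain Tt'].
exists (t' + t2); first exact: submoduleD.
by exists q2 => //; rewrite -addrA qE.
Qed.

(** The quotient has dimension at most 1 over the residue field. Either each [T k] contains an
    element with unit coefficient at [e], and then covers the quotient, or some [T k0] meets it
    trivially. *)
Lemma stabilizes_cyclic P e : is_submodule P -> (forall b, m b -> P (b *: e)) ->
  stabilizes [set x | exists b q, P q /\ x = b *: e + q] P.
Proof.
move=> PP me; have [H|/existsNP[k0 H]] := pselect (forall k, exists b q,
    [/\ ~ m b, P q & T k (b *: e + q)]).
  exists 0%N => k _ _ _ [b [q [Pq ->]]]; have [c [r [mc Pr Tk]]] := H k.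
  have [d dc] := unitm mc.
  exists ((b * d) *: (c *: e + r)); first exact: submoduleZ.
  exists (q - (b * d) *: r); first by apply: submoduleB => //; exact: submoduleZ.
  by rewrite scalerDr scalerA -mulrA dc mulr1 -addrA [_ + (q - _)]addrCA subrr addr0.
exists k0 => k _ t Tt [b [q [Pq tE]]]; apply: sumsetr => //.
rewrite tE; apply: submoduleD => //; apply: me; apply: contrapT => nmb; apply: H.
by exists b, q; split; rewrite -?tE.
Qed.

Lemma stabilizes_span P (s : seq F) : is_submodule P ->
  (forall e b, e \in s -> m b -> P (b *: e)) -> stabilizes (sumset (span [set` s]) P) P.
Proof.
move=> PP; elim: s => [|e s IHs] sP.
  exists 0%N => k _ t _ [x x0 [q Pq <-]]; apply: sumsetr => //.
  by have [g ->] := span_seqP x0; rewrite big_ord0 add0r.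
pose Q := sumset (span [set` s]) P.
have QQ : is_submodule Q by apply: sumset_submodule => //; exact: span_submodule.
pose Q' := [set x | exists b q, Q q /\ x = b *: e + q].
have QQ' : is_submodule Q'.
  apply/is_submoduleP; split=> [|_ _ [a [q [Qq ->]]] [b [r [Qr ->]]]|c _ [a [q [Qq ->]]]].
  - by exists 0, 0; split; [exact: submodule0|rewrite scale0r addr0].
  - by exists (a + b), (q + r); split; [exact: submoduleD|rewrite scalerDl addrACA].
  - by exists (c * a), (c *: q); split; [exact: submoduleZ|rewrite scalerDr scalerA].
suff [k0 H0] : stabilizes Q' P.
  exists k0 => k k0k t Tt tQ; apply: H0 => //.
  case: tQ => x /span_seqP[g ->] [q Pq <-]; rewrite big_ord_recl -addrA /=.
  exists (g 0%N), (\sum_(i < size s) g i.+1 *: s`_i + q); split=> //.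
  exists (\sum_(i < size s) g i.+1 *: s`_i); last by exists q.
  apply: submodule_sum; first exact: span_submodule.
  move=> i _; apply: (submoduleZ _ (span_submodule _)); apply: span_mem.
  exact: mem_nth.
apply: (@stabilizes_trans _ Q) => //.
- by move=> q Qq; exists 0, q; rewrite scale0r add0r.
- apply: stabilizes_cyclic => // b mb; apply: sumsetr; first exact: span_submodule.
  by apply: sP => //; rewrite mem_head.
- by apply: IHs => x b xs; apply: sP; rewrite inE xs orbT.
Qed.

(** Each layer [m^n F / m^(n+1) F] is finite dimensional over the residue field, and stabilization
    passes through successive layers. *)
Lemma stabilizes_powm n : stabilizes [set: F] (powm m F n).
Proof.
elim: n => [|n IHn].
  by rewrite powm0; exists 0%N => k _ t _ _; apply: sumsetr.
apply: stabilizes_trans IHn _ => //; first exact: submoduleT.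
- exact: powm_submodule.
- have [s sn ns] := acc_fg (powm m F n) accF.
  have [|e b es mb|k0 H0] := @stabilizes_span (powm m F n.+1) s.
  + exact: powm_submodule.
  + rewrite -add1n; apply: powm_scale; last exact: sn.
    exact/powm1.
  + exists k0 => k k0k t Tt nt; apply: H0 => //.
    apply: sumsetl; first exact: powm_submodule.
    by rewrite -ns; exact: span_mem.
Qed.

(** The contrapositive of Chevalley's theorem. Starting from [z0] outside [m^N F], stabilization
    lifts [z i] to a deeper [T], changing it only within [m^(N+i) F]; the limit in the completion is
    [xi]. *)
Lemma chevalley N : (forall k, exists2 t, T k t & ~ powm m F N t) ->
  exists2 xi : completion m F, xi != 0 &
    forall k l, exists2 t, T k t & cpow l (xi - to_completion m t).
Proof.
move=> TN; have /choice[ka0 Hka0] := stabilizes_powm.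
(* The sum makes [ka] nondecreasing and at least both [n] and [ka0 n]. *)
pose ka n := (n + \sum_(i < n.+1) ka0 i)%N.
have ka_S n : (ka n <= ka n.+1)%N.
  by rewrite /ka [X in (_ <= _ + X)%N]big_ord_recr /=; lia.
have ka_ge n : (n <= ka n)%N by exact: leq_addr.
have ka0_le n : (ka0 n <= ka n)%N by rewrite /ka big_ord_recr /=; lia.
have Hka n t : T (ka n) t -> exists2 t', T (ka n.+1) t' & powm m F n (t' - t).
  move=> Tt; have [|t' Tt' [q nq tE]] := Hka0 n (ka n.+1) _ t (T_chain (ka0_le n) Tt) Logic.I.
    exact: leq_trans (ka0_le n) (ka_S n).
  exists t' => //; rewrite -tE opprD addrA subrr add0r.
  exact: (submoduleN (powm_submodule m F n)).
have /choice[g gP] (nt : nat * F) : exists t', T (ka (N + nt.1)%N) nt.2 ->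
    T (ka (N + nt.1.+1)%N) t' /\ powm m F (N + nt.1) (t' - nt.2).
  have [/Hka[t' ? ?]|nT] := pselect (T (ka (N + nt.1)%N) nt.2); last by exists 0.
  by exists t' => _; rewrite addnS.
have [z0 Tz0 nz0] := TN (ka N).
pose z := fix z i := if i is i'.+1 then g (i', z i') else z0.
have Tz i : T (ka (N + i)%N) (z i).
  by elim: i => [|i IHi]; [rewrite addn0|have [] := gP (i, z i) IHi].
have zS i : powm m F (N + i) (z i.+1 - z i) by have [] := gP (i, z i) (Tz i).
have [|xi xiP] := @cpow_lim B m F 0 z.
  by move=> i; rewrite subn0; apply: powmS (zS i); exact: leq_addl.
have zN i : powm m F N (z i - z0).
  elim: i => [|i IHi]; first by rewrite subrr; exact: submodule0 (powm_submodule m F N).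
  rewrite -(subrK (z i) (z i.+1)) -addrA; apply: (submoduleD (powm_submodule m F N)) => //.
  by apply: powmS (zS i); exact: leq_addr.
exists xi => [|k l].
  (* All [z i] agree with [z0] modulo [m^N F]; if [xi] were 0, then [z N], and with it [z0], would
     lie in [m^N F]. *)
  apply/eqP => xi0; apply: nz0; rewrite -(subKr (z N) z0).
  apply: (submoduleB (powm_submodule m F N)) => //.
  apply/(cpow_to_completion m); have := xiP N; rewrite subn0 xi0 sub0r.
  by move=> /(submoduleN (@cpow_submodule B m F N)); rewrite opprK.
exists (z (maxn k l)).
  by apply: T_chain (Tz _); rewrite /ka; lia.
by apply: cpow_chain (xiP _); rewrite subn0 leq_maxr.
Qed.

End LocalUnits.
End CompletionSubmodules.

(** * Quintessential primes of a principal ideal *)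

Section Quintessential.
Variables (A : comPzRingType) (M : lmodType A) (P : prime_ideal A).
Hypothesis accA : acc A^o.

Let B := loc_ring P.
Let m : set B := @loc_max A P.

Lemma to_fracM a b : to_frac (prime_compl P) (a * b) =
  (to_frac (prime_compl P) a : B) * to_frac (prime_compl P) b.
Proof. exact: (esym (@to_frac_scale A (prime_compl P) A^o a b _)). Qed.

Lemma to_hatM a b : to_hat P (a * b) = to_hat P a * to_hat P b.
Proof. by rewrite /to_hat to_fracM to_completion_ringM. Qed.

Lemma to_hatX a n : to_hat P (a ^+ n) = to_hat P a ^+ n.
Proof. by elim: n => // n IHn; rewrite !exprS to_hatM IHn. Qed.

(** The extension of [P] is spanned algebraically while [cpow 1] is a closure; they agree because
    [P A_P] has finitely many generators. Non-units of the completed ring are thereby located in the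
    extension of [P]. *)
Lemma hat_maxE : extension (to_hat P) P = @cpow B m B^o 1.
Proof.
have accB := @acc_loc_ring A P accA.
apply/seteqP; split.
  apply: (@span_ind _ (hat_ring P)^o).
    exact: (@cpow_submodule B m B^o 1).
  move=> _ [a Pa <-]; apply/cpow_to_completion; apply/powm1; first exact: loc_max_ideal.
  by apply: (@span_mem _ B^o); exists a.
have [s sP mE] := @acc_fg B B^o (to_frac (prime_compl P) @` P) accB.
apply: (@subset_trans _ (@span _ (hat_ring P)^o [set` map (@to_completion B m B^o) s])).
  apply: (@cpow_span B m B^o 1) => b /powm1 -/(_ (loc_max_ideal P)) mb.
  by rewrite -mE.
by apply: span_mono => _ /mapP[b /sP [a Pa <-] ->]; exists a.
Qed.

(** Let [z] be an associated prime of the form [annihilator (b *: xi)]. The radical of [J + z] lies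
    in the maximal ideal, and differs from it since [P] is not quintessential. So some [e] of the
    maximal ideal has no power in [J + z], and a prime [w] contains [J + z] but not [e]. Elements
    outside [P] become units, so [w] contracts into [P]. *)
Lemma exists_separating_prime (J : set A) (xi : hat_mod P M) :
  J `<=` P -> ~ quint_primes J M P -> xi != 0 ->
  exists w : set (hat_ring P), [/\ is_prime w,
    forall a, J a -> w (to_hat P a), annihilator xi `<=` w,
    forall a, w (to_hat P a) -> (P : set A) a &
    ~ forall a, (P : set A) a -> w (to_hat P a)].
Proof.
move=> JP nPQ xi0.
have accB := @acc_loc_ring A P accA.
have idm := loc_max_ideal P.
have accH : acc (hat_ring P)^o := acc_completion_ring idm accB.
have [b bxi0 primez] := exists_prime_annihilator accH xi0.
set z := annihilator _ in primez.
have idz : is_ideal z by case: primez.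
apply: contrapT => noW; apply: nPQ; exists P => //; exists z.
  by split=> //; exists (b *: xi).
set Jz := ideal_add _ z.
have idJz : is_ideal Jz.
  by apply: (@sumset_submodule _ (hat_ring P)^o) => //; exact: span_submodule.
have n1 : ~ @cpow B m B^o 1 (1 : hat_ring P).
  by move/(@cpow_to_completion B m B^o 1 1)/(powm1 idm); exact: loc_max1.
have unitH (e : hat_ring P) : ~ @cpow B m B^o 1 e -> exists c, c * e = 1.
  apply: completion_unit => //; exact: loc_unit.
rewrite hat_maxE; apply/seteqP; split=> e.
  move=> [k ek]; apply: contrapT => /unitH[c ce]; apply: n1.
  rewrite -[1](expr1n _ k) -ce exprMn; apply: (idealMl (cpow1_ideal m)).
  case: ek => j Jj [d zd <-]; apply: (idealD (cpow1_ideal m)).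
    rewrite -hat_maxE; move: j Jj; apply: (@span_mono _ (hat_ring P)^o).
    by move=> _ [a /JP Pa <-]; exists a.
  apply: contrapT => /unitH[d' dd]; move/eqP: bxi0; apply.
  by rewrite -[b *: xi]scale1r -dd -scalerA zd scaler0.
move=> me; apply: contrapT => nrad; apply: noW.
have [|w [primew Jw we]] := @exists_prime_avoiding _ Jz e accH idJz.
  by move=> n Jen; apply: nrad; exists n.
have idw : is_ideal w by case: primew.
exists w; split=> //.
- move=> a Ja; apply: Jw; exists (to_hat P a); last by exists 0; rewrite ?addr0 //; exact: ideal0.
  by apply: (@span_mem _ (hat_ring P)^o); exists a.
- move=> d dxi; apply: Jw; exists 0; first exact: (@submodule0 _ (hat_ring P)^o _ (span_submodule _)).
  exists d; last by rewrite add0r.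
  by rewrite /z /annihilator /= scalerA mulrC -scalerA dxi scaler0.
- move=> a wa; apply: contrapT => nPa; case: primew => _ + _; apply.
  have [|c cE] := @loc_unit A P (to_frac (prime_compl P) a).
    by move/loc_maxP.
  suff -> : 1 = to_completion_ring m c * to_hat P a by exact: idealMl.
  by rewrite -to_completion_ringM cE.
- move=> Pw; apply: we; move: e me {nrad}; rewrite -hat_maxE.
  by apply: (@span_ind _ (hat_ring P)^o) => // _ [a /Pw wa <-].
Qed.

End Quintessential.

(** * Krull's theorem at a prime and symbolic powers of a principal ideal *)

Lemma zero_submodule (A : comPzRingType) (M : lmodType A) : is_submodule [set (0 : M)].
Proof.
apply/is_submoduleP; split=> //= [_ _ -> ->|a _ ->]; first by rewrite addr0.
by rewrite scaler0.
Qed.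

Lemma prime_expr (A : comPzRingType) (w : set A) (a : A) (n : nat) :
  is_prime w -> w (a ^+ n) -> w a.
Proof.
move=> [_ w1 wM]; elim: n => [|n IHn]; first by rewrite expr0.
by rewrite exprS => /wM[|/IHn].
Qed.

(** The submodule [L] of [krull_submodule] contains [u^l M] for some [l] and meets [A x] inside
    [w x]. Hence [c^l x = a x] with [a] in [w], and [c^l - a] kills [x]. *)
Lemma krull_prime (A : comPzRingType) (M : lmodType A) (w : set A) (u : A) (x : M) :
  acc M -> is_prime w -> w u -> annihilator x `<=` w ->
  exists l, forall c y, c ^+ l *: x = u ^+ l *: y -> w c.
Proof.
move=> accM pw wu annw; have [idw _ _] := pw.
have [K subK [_ Kw Kx]] := krull_submodule x accM (@zero_submodule A M) idw.
have [l Kl] := Kw u wu; exists l => c y cx.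
have [||a [_ [wa -> E]]] := Kx (c ^+ l) 0 => //.
  by rewrite addr0 cx.
rewrite !addr0 in E; apply: (@prime_expr _ _ _ l) => //.
rewrite -(subrK a (c ^+ l)); apply: idealD => //; apply: annw.
by rewrite /annihilator /= scalerBl E subrr.
Qed.

Section PrincipalSymbolicPowers.
Variables (A : comPzRingType) (M : lmodType A) (u : A) (S : mul_set A).
Hypotheses (accA : acc A^o) (accM : acc M).
Hypothesis regu : forall x : M, u *: x = 0 -> x = 0.

(** These are the submodules [T_n] of the outline, for a general module and a general multiplicative
    set. *)
Definition spow (n : nat) : set M :=
  [set x | exists s y, (S : set A) s /\ s *: x = u ^+ n *: y].

Lemma spow_submodule n : is_submodule (spow n).
Proof.
apply/is_submoduleP; split=> [|x x' [s [y [Ss E]]] [s' [y' [Ss' E']]]|a x [s [y [Ss E]]]].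
- by exists 1, 0; rewrite !scaler0; split=> //; exact: mul_set1.
- exists (s * s'), (s' *: y + s *: y'); split; first exact: mul_setM.
  rewrite !scalerDr; congr (_ + _); last by rewrite -scalerA E' !scalerA mulrC.
  by rewrite mulrC -scalerA E !scalerA mulrC.
- by exists s, (a *: y); split=> //; rewrite scalerA mulrC -scalerA E !scalerA mulrC.
Qed.

Lemma spowS n : spow n.+1 `<=` spow n.
Proof. by move=> x [s [y [Ss E]]]; exists s, (u *: y); rewrite E exprSr scalerA. Qed.

Lemma regular_inj (x y : M) : u *: x = u *: y -> x = y.
Proof. by move=> E; apply/eqP; rewrite -subr_eq0; apply/eqP/regu; rewrite scalerBr E subrr. Qed.

Lemma spow_div n (x : M) : spow n.+1 (u *: x) -> spow n x.
Proof.
move=> [s [y [Ss E]]]; exists s, y; split=> //; apply: regular_inj.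
by rewrite scalerA mulrC -scalerA E exprS scalerA.
Qed.

(** If [c x = u y], regularity of [u] lowers the order of [y] by just one, so the induction
    continues with [y]. The case [c = 1] yields the final linear bound; a [c] outside [w] feeds
    Krull's theorem. *)
Lemma spow_linear c k : (forall x, spow k x -> exists y, c *: x = u *: y) ->
  forall l x, spow (l + k) x -> exists y, c ^+ l *: x = u ^+ l *: y.
Proof.
move=> Hk; elim=> [|l IHl] x lx; first by exists x; rewrite !expr0.
have [|y xy] := Hk x.
  by apply: (@T_chain _ _ spow) lx; [exact: spowS|exact: leq_addl].
have [|y' yE] := IHl y.
  by apply: spow_div; rewrite -addSn -xy; apply: submoduleZ => //; exact: spow_submodule.
exists y'; rewrite exprSr -scalerA xy scalerA mulrC -scalerA yE scalerA.
by rewrite exprS.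
Qed.


(** The contradiction argument of the outline as a descent step: the assumption [nobad] acts as the
    minimality of the radical [p i]. *)
Lemma exists_smaller_bad_component (n : nat) (L : nat -> set M) (p : nat -> set A) (i : nat) :
  (forall P : prime_ideal A, @quint_primes A (@span A A^o [set u]) M P ->
     forall s, (S : set A) s -> ~ (P : set A) s) ->
  (forall j, (j < n)%N -> primary_component [set u *: y | y in [set: M]] (L j) (p j)) ->
  (forall x, (forall j, (j < n)%N -> L j x) -> exists y, x = u *: y) ->
  (i < n)%N -> (forall k, ~ spow k `<=` L i) ->
  exists2 j, (j < n)%N /\ (forall k, ~ spow k `<=` L j) & p j `<=` p i /\ ~ p i `<=` p j.
Proof.
move=> hypQ decL LU lin badi; apply: contrapT => nobad.
have [[subL UL] primep Lreg Lnil] := decL i lin.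
pose P := PrimeIdeal primep.
(* If [S] missed [P], its elements would act injectively modulo [L i], and [T_1] would lie in
   [L i]. *)
have [s Ss Ps] : exists2 s, (S : set A) s & (P : set A) s.
  apply: contrapT => nS; apply: (badi 1%N) => x [s [y [Ss E]]].
  apply: (Lreg s) => [ps|]; first by apply: nS; exists s.
  by rewrite E; apply: UL; exists y; rewrite ?expr1.
have Pu : (P : set A) u.
  apply: contrapT => npu; apply: (badi 0%N) => x _; apply: (Lreg u) => //.
  by apply: UL; exists x.
pose B := loc_ring P; pose m : set B := @loc_max A P; pose F := loc_mod P M.
have accB : acc B^o := @acc_loc_ring A P accA.
have accF : acc F := @acc_frac A (prime_compl P) M accM.
have idm : is_ideal m := loc_max_ideal P.
pose T k : set F := @frac_set A (prime_compl P) M (spow k).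
have TT k : is_submodule (T k) by apply: frac_set_submodule; exact: spow_submodule.
have T_S k : T k.+1 `<=` T k.
  by move=> _ [x [t [/spowS kx ->]]]; exists x, t.
pose LF : set F := @frac_set A (prime_compl P) M (L i).
have subLF : is_submodule LF by exact: frac_set_submodule.
(* A power of the maximal ideal carries [F] into the localized component, so no [T k] lies in
   [m^N F] and Chevalley's lemma applies. *)
have [N NLF] : exists N, powm m F N `<=` LF.
  have [|N HN] := @ideal_pow_sub B (to_frac (prime_compl P) @` P) _ accB (conductor_ideal subLF).
    move=> _ [a Pa <-]; have [k Lk] := Lnil a Pa; exists k => x; elim/fracW: x => x t.
    suff -> : (to_frac (prime_compl P) a : B) ^+ k = to_frac (prime_compl P) (a ^+ k).
      by rewrite to_frac_scale; exists (a ^+ k *: x), t.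
    by elim: k {Lk} => // k IHk; rewrite !exprS to_fracM IHk.
  exists N; apply: span_ind => // _ [b /HN Kb [x _ <-]]; exact: Kb.
have badT k : exists2 t, T k t & ~ powm m F N t.
  have /existsNP[x /not_implyP[kx nLx]] := badi k.
  exists (mk_frac x (denom1 _)); first by exists x, (denom1 _).
  move=> /NLF /(frac_setP subL)[t Ltx]; apply: nLx.
  by apply: (Lreg (den t)) => //; exact: denP t.
have [xi xi0 xiT] := chevalley idm (@loc_unit A P) accF TT T_S badT.
have [||w [primew uw annw wP nPw]] := @exists_separating_prime A M P accA
    (@span A A^o [set u]) xi _ _ xi0.
- by apply: (@span_ind A A^o) => [|_ ->//]; exact: prime_ideal_ideal.
- by move=> qP; exact: (hypQ P qP s Ss Ps).
have idw : is_ideal w by case: primew.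
have [_ nw1 wM] := primew.
have {}uw : w (to_hat P u) by apply: uw; exact: (@span_mem A A^o).
(* The multiplier [c] is a product over the components, built one component at a time; it stays
   outside [w] because [w] is prime. *)
have [c [k [nwc Hc]]] : exists c k, ~ w (to_hat P c) /\
    forall x, spow k x -> forall j, (j < n)%N -> L j (c *: x).
  have : (n <= n)%N by []. elim: {-2}n => [_|j IHj jn].
    by exists 1, 0%N; split.
  have [c [k [nwc Hc]]] := IHj (ltnW jn).
  have [[subLj _] [_ _ _] _ Ljnil] := decL j jn.
  suff [d [l [nwd Hd]]] : exists d l, ~ w (to_hat P d) /\
      forall x, spow l x -> L j (d *: x).
    exists (c * d), (maxn k l); split; first by rewrite to_hatM => /wM[].
    move=> x klx j'; rewrite ltnS leq_eqVlt => /predU1P[->|j'j].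
      rewrite -scalerA; apply: submoduleZ => //; apply: Hd.
      by apply: (T_chain spowS (leq_maxr k l)).
    have [[subLj' _] _ _ _] := decL j' (ltn_trans j'j jn).
    rewrite mulrC -scalerA; apply: submoduleZ => //; apply: Hc => //.
    by apply: (T_chain spowS (leq_maxl k l)).
  (* If [p j] maps into [w], it is strictly smaller than [p i], so [L j] contains some [T_l] and 1
     is a suitable factor. Otherwise a power of some [d] in [p j] outside [w] carries all of [M]
     into [L j]. *)
  have [pjw|/existsNP[d /not_implyP[pd nwd]]] :=
    pselect (forall d, p j d -> w (to_hat P d)).
    have [l jl] : exists l, spow l `<=` L j.
      apply: contrapT => badj; apply: nobad; exists j.
        by split=> // l jl; apply: badj; exists l.
      split=> [d /pjw /wP //|pij]; apply: nPw => d /pij; exact: pjw.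
    by exists 1, l; split=> // x /jl; rewrite scale1r.
  have [l Hl] := Ljnil d pd; exists (d ^+ l), 0%N; split; last by move=> x _; exact: Hl.
  by rewrite to_hatX => /(prime_expr primew).
have Uc x : spow k x -> exists y, c *: x = u *: y.
  by move=> kx; apply: LU => j jn; exact: Hc.
have accH := @acc_completion_ring B m idm accB.
have accHF := @acc_completion B m idm accB F accF.
have [l Hl] := krull_prime accHF primew uw annw.
apply: nwc; suff [y _ yE] : [set to_hat P u ^+ l *: y | y in setT] (to_hat P c ^+ l *: xi).
  by apply: (Hl _ y); rewrite yE.
(* Divisibility by [u^l] is a closed condition, so it can be checked on elements of [T (l + k)]
   approximating [xi], where [spow_linear] gives it. *)
apply: (completion_closed idm accB accF).
  by apply: scale_image_submodule; exact: submoduleT.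
move=> r; have [t Tt rt] := xiT (l + k)%N r; case: Tt => x [d [lkx tE]].
have [y xy] := spow_linear Uc lkx.
exists (to_hat P c ^+ l *: to_completion m t).
  exists (to_completion m (mk_frac y d : F)) => //.
  rewrite tE -!to_hatX.
  rewrite -[LHS](@to_completionZ B m F) -[RHS](@to_completionZ B m F).
  by rewrite !to_frac_scale xy.
rewrite -scalerBr -[r]add0n; apply: (@cpow_scale B m F) => //; exact: cpow0.
Qed.

Lemma spow_sub_principal :
  (forall P : prime_ideal A, @quint_primes A (@span A A^o [set u]) M P ->
     forall s, (S : set A) s -> ~ (P : set A) s) ->
  exists k, forall x, spow k x -> exists y, x = u *: y.
Proof.
move=> hypQ.
have uM : is_submodule [set u *: y | y in [set: M]].
  by apply: scale_image_submodule; exact: submoduleT.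
have [n [L [p [decL LU]]]] := primary_decomposition accM uM.
have {}LU x : (forall j, (j < n)%N -> L j x) -> exists y, x = u *: y.
  by move=> /LU [y _ <-]; exists y.
pose bad i := (i < n)%N /\ forall k, ~ spow k `<=` L i.
have [allgood|/existsNP[i /contrapT badi]] := pselect (forall i, ~ bad i).
  suff [k Hk] : exists k, forall x, spow k x -> forall j, (j < n)%N -> L j x.
    by exists k => x /Hk; exact: LU.
  have : (n <= n)%N by []. elim: {-2}n => [_|j IHj jn]; first by exists 0%N.
  have [k Hk] := IHj (ltnW jn).
  have [l Hl] : exists l, spow l `<=` L j.
    by apply: contrapT => nl; apply: (allgood j); split=> // l jl; apply: nl; exists l.
  exists (maxn k l) => x klx j'; rewrite ltnS leq_eqVlt => /predU1P[->|].
    by apply: Hl; exact: (T_chain spowS (leq_maxr k l)).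
  by apply: Hk; exact: (T_chain spowS (leq_maxl k l)).
(* The number of components with radical inside [p i] measures the descent: passing to a strictly
   smaller radical loses at least the index [i] itself. *)
pose mu i := #|[pred j : 'I_n | `[< p j `<=` p i >] ]|.
have exbad : exists k, `[< exists2 i, bad i & mu i = k >].
  by exists (mu i); apply/asboolP; exists i.
case: (ex_minnP exbad) => _ /asboolP[{badi}i badi <-] imin.
have [j badj [pji npij]] := exists_smaller_bad_component hypQ decL LU badi.1 badi.2.
have := imin (mu j); rewrite leqNgt => /(_ _)/negP[].
  by apply/asboolP; exists j.
apply: proper_card; apply/properP; split.
  by apply/fintype.subsetP => a /asboolP aj; apply/asboolP; exact: subset_trans pji.
exists (Ordinal badi.1); first exact/asboolP.
exact/asboolP.
Qed.

End PrincipalSymbolicPowers.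

(** * Transfer to the extended Rees module and the theorem *)

Section EssentialPrimes.
Variables (R : comPzRingType) (I : set R) (N : lmodType R).

Lemma rees_cstM (a b : R) : rees_cst I (a * b) = rees_cst I a * rees_cst I b.
Proof.
apply: (@rees_eq R I R^o) => n.
rewrite -[RHS]/((rees_cst I a *: (rees_cst I b : rees I R^o)) n) rees_cstE /=.
by case: eqP => // _; rewrite scaler0.
Qed.

Lemma rees_uX (n : nat) (f : rees I N) (i : int) :
  (rees_u I ^+ n *: f) i = f (i + n%:Z).
Proof.
elim: n i => [|n IHn] i; first by rewrite expr0 scale1r addr0.
by rewrite exprS -scalerA rees_uE IHn -addrA.
Qed.

Lemma rees_u_regular (f : rees I N) : rees_u I *: f = 0 -> f = 0.
Proof. by move=> uf; apply: rees_eq => n; rewrite -[n](subrK 1) -rees_uE uf. Qed.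

Fact symb_denom1 : symb_denom I N 1.
Proof. by move=> [p [[[_ p1 _] _] _] /p1]. Qed.

Fact symb_denomM a b :
  symb_denom I N a -> symb_denom I N b -> symb_denom I N (a * b).
Proof.
move=> na nb [p mp pab]; have [[[_ _ pM] _] _] := mp.
by case: (pM _ _ pab) => [pa|pb]; [apply: na|apply: nb]; exists p.
Qed.

Fact rees_denom1 : (rees_cst I @` symb_denom I N) 1.
Proof. by exists 1 => //; exact: symb_denom1. Qed.

Fact rees_denomM s t : (rees_cst I @` symb_denom I N) s ->
  (rees_cst I @` symb_denom I N) t -> (rees_cst I @` symb_denom I N) (s * t).
Proof.
move=> [a Sa <-] [b Sb <-]; exists (a * b); first exact: symb_denomM.
exact: rees_cstM.
Qed.

Definition rees_denom : mul_set (rees_ring I) := MulSet rees_denom1 rees_denomM.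

Lemma symb_pow_spow n (x : N) (f : rees I N) :
  symb_pow I N n x -> (forall i, f i = if i == 0 then x else 0) ->
  spow (rees_u I) rees_denom n f.
Proof.
move=> [a Sa nax] fE; exists (rees_cst I a), (monom (nax : powmz I N (Posz n) (a *: x))).
split; first by exists a.
apply: rees_eq => i; rewrite rees_uX rees_cstE fE /=.
have -> : (i + Posz n == Posz n) = (i == 0) by lia.
by case: eqP => // _; rewrite scaler0.
Qed.

End EssentialPrimes.

Theorem theorem1p2 (R : comNzRingType) (N : lmodType R) (I : set R)
    (noethR : noetherian R)
    (fgN : finitely_generated N)
    (N_neq0 : exists x : N, x != 0)
    (idI : is_ideal I)
    (N_proper : exists x : mod_IN I N, x != 0)
    (EI : ess_primes I N = mAss (mod_IN I N)) :
  exists k : nat, forall n : nat, symb_pow I N (n + k) `<=` powm I N n.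
Proof.
have accR := noetherian_acc noethR.
have accN := acc_finitely_generated accR fgN.
have [||||k Hk] := @spow_sub_principal _ (rees I N) (rees_u I) (rees_denom I N).
- exact: acc_rees_ring.
- exact: acc_rees.
- exact: rees_u_regular.
(* The contraction of a quintessential prime is essential, hence a minimal associated prime by [EI],
   and so it contains no element of [S]. *)
- move=> P PQ _ [a Sa <-] Pa; apply: Sa; exists (rees_cst I @^-1` P) => //.
  by rewrite -EI; exists P.
exists k => n x nkx.
pose f : rees I N := monom (n := 0) (M := N) (x := x)
  (eq_ind_r (fun P : set N => P x) Logic.I (powm0 I N)).
(* With [c = 1], the degree 0 monomial [f] equals [u^n y]; comparing coefficients in degree 0
   identifies [x] with the coefficient of [y] in degree [n], which lies in [I^n N]. *)
have [|||y] := @spow_linear _ _ (rees_u I) (rees_denom I N) _ 1 k _ n f.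
- exact: rees_u_regular.
- by move=> g /Hk[z ->]; exists z; rewrite scale1r.
- exact: symb_pow_spow nkx _.
rewrite expr1n scale1r => /(congr1 (fun g : rees I N => g 0)).
by rewrite rees_uX /= add0r => ->; exact: (reesP y).2 (Posz n).
Qed.
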